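(* Let $K\subset S^3$ be a link with $\det(K)\ne 0$, and let $D$ be a connected diagram of $K$ with a marked point $p$, a checkerboard colouring, and a marked crossing. Let $x$ and $y$ be Kauffman states of $D$, and let $\mathcal D$ be the domain connecting $x$ to $y$ in the Heegaard diagram $\mathcal H_2(D)$. Let $\mathcal D_\alpha$, $\mathcal D_B$, $\mathcal D_W$ be the rational vectors of coefficients of $\mathcal D$ on the regions of $\mathcal H_2(D)$ corresponding, respectively, to the unmarked arcs, unmarked black regions and unmarked white regions of $D$. Then $$\mathcal D_\alpha=A^{-1}(\xi_x-\xi_y),\qquad \mathcal D_B=-\tfrac12\,G_B^{-1}(v^B_x-v^B_y),\qquad \mathcal D_W=\tfrac12\,G_W^{-1}(v^W_x-v^W_y),$$ where $A$ is the coloring matrix, $G_B,G_W$ are the Goeritz matrices, $v^B,v^W$ are the degrees vectors and $\xi_x,\xi_y$ are the colour-indicator vectors of $x,y$.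
   Context: Diagrams, graphs, incidence numbers. $D$ is regarded as a 4-valent plane graph whose vertices are the crossings. The black and white regions adjacent to $p$ are the marked regions. The black graph $B$ has one vertex per black region and one edge per crossing, joining the two black regions incident to it (drawn through the crossing); $W$ is defined likewise from white regions. A crossing $c$ has $\mu(c)=+1$ if rotating the overstrand counterclockwise about $c$ until it reaches the understrand sweeps out the two white corners at $c$, and $\mu(c)=-1$ if it sweeps out the two black corners; edges of $B$, $W$ at $c$ get $\mu(e)=\mu(c)$. Matrices. $G_B=(g_{ij})$, indexed by the unmarked black regions $b_1,\dots,b_\ell$: $g_{ij}=\sum_{e\text{ joining }b_i,b_j}\mu(e)$ for $i\neq j$, and $g_{ii}=-\sum\mu(e)$ over the (non-loop) edges incident to $b_i$. $G_W$ is defined the same way (with the same $\mu$) from the unmarked white regions $w_1,\dots,w_m$. An arc of $D$ is a strand running from undercrossing to undercrossing; the arc containing $p$ is marked. Let $c_1,\dots,c_k$ be the unmarked crossings and $\alpha_1,\dots,\alpha_k$ the unmarked arcs. The coloring matrix $A=(a_{ij})$ has $a_{ij}=\mu(c_i)$ if $\alpha_j$ is an understrand at $c_i$, $-2\mu(c_i)$ if $\alpha_j$ is the overstrand at $c_i$, and $0$ otherwise (contributions being added if $\alpha_j$ occurs more than once at $c_i$). All three matrices are invertible since $\det(K)\ne0$. Kauffman states. A Kauffman state $x$ assigns to each crossing $c$ one of the four corners $x(c)$ at $c$, so that each unmarked region contains exactly one chosen corner and the marked regions none. $\xi_x=(\xi(x,c_i))_{i}$, with $\xi(x,c)=1$ if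 $x(c)$ lies in a black region and $0$ if it lies in a white region. Given $x$, orient each edge of $W$ (resp. $B$) at crossing $c$ towards the white (resp. black) region whose corner at $c$ lies on the same side of the overstrand as $x(c)$; $v^W_x$ (resp. $v^B_x$) is the vector, indexed by unmarked white (resp. black) regions, whose entry at a vertex is the number of edges directed out of it minus the number directed into it. The Heegaard diagram $\mathcal H_2(D)=(\Sigma,\alpha,\beta,z)$. Choose a spanning tree $T$ of $B$ with dual tree $T^*\subset W$ (the edges of $W$ at crossings whose $B$-edge is not in $T$); let $e_c$ be the edge of $T\cup T^*$ through $c$. (Up to diffeomorphism the result does not depend on $T$.) $\Sigma$ is the boundary of a closed regular neighbourhood $U$ of $D$ in $S^3$; the plane divides it into a top and a bottom half. The $\alpha$ curves are the intersections of $\Sigma$ with all regions of $D$ except the marked white one; write $\alpha_R$ for the curve of $R$ and $\delta_1$ for the intersection of $\Sigma$ with the marked white region. The $\beta$ curves are a meridian $\beta_p$ of the marked edge near $p$ and one curve $\beta_c$ per crossing $c$. On top, $\beta_c$ consists of two arcs, one crossing each of the two understrand edge-ends at $c$, each joining the curves ($\alpha_R$ or $\delta_1$) of the two regions on the two sides of that edge-end near their corners at $c$. On the bottom, $\beta_c$ consists of two arcs: the first is the projection of the part of $e_c$ in $U$, joining two opposite corners at $c$; cutting the bottom half along all these first arcs gives an annulus, cutting further along the bottom arc of $\beta_p$ gives a disk, and the second arc of $\beta_c$ lies in this disk and joins the remaining two endpoints, these second arcs being mutually disjoint (unique up to isotopy). The basepoint $z$ is next to $\beta_p$ near $p$. The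 Kauffman state $x$ is identified with the tuple consisting of the unique point of $\beta_p$ on an $\alpha$ curve and, for each $c$, the point of $\beta_c\cap \alpha_R$ at the corner $x(c)$ of $R$. Regions of $\mathcal H_2(D)$, i.e. components of $\Sigma\setminus(\alpha\cup\beta)$. For an arc $a$ of $D$, $R_a$ is the region containing the part of the top half lying over $a$. For a region $v$ of $D$, $R_v$ is the region whose part in the bottom half is adjacent, along each edge of $D$ on the boundary of $v$, to the curve ($\alpha_s$ or $\delta_1$) of the region $s$ on the other side of that edge. (Some $R_a$, $R_v$ coincide; those of the marked arc and marked regions coincide with the region containing $z$.) Domain. Orient $\Sigma$ and the $\alpha$ and $\beta$ curves, and let $\{\eta_i\}$ be the oriented segments of these curves between consecutive intersection points. Let $\epsilon(x,y)$ be a 1-cycle made of an arc on each $\alpha$ curve from the point of $x$ to the point of $y$ on it and an arc on each $\beta$ curve from the point of $y$ to the point of $x$ on it. Since the Heegaard diagram presents a rational homology sphere (the branched double-cover of $K$), $\epsilon(x,y)$, after adding a suitable rational combination of full $\alpha$ and $\beta$ curves, can be written $\sum_i d_i\eta_i$ and bounds a rational 2-chain $\sum_j q_jR_j$ (a combination of the regions), meaning $q_j-q_k=d_i$ whenever $R_j$ and $R_k$ abut along $\eta_i$ to its left and right, respectively. The domain $\mathcal D$ connecting $x$ to $y$ is the unique such 2-chain with coefficient $0$ on the region containing $z$; no assumption is made on the class of $\epsilon(x,y)$ in first homology.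
   Formalization: As printed, the three formulas cannot hold together for any orientation of Σ (the Hopf link is a counterexample); proved instead: D_α = −ε A⁻¹(ξ_x−ξ_y), with the printed right sides of D_B and D_W multiplied by ε, where ε = +1 if Σ is oriented as the boundary of U and −1 otherwise. *)

(* Defs.v *)
From mathcomp Require Import all_boot all_order all_algebra.

Set Implicit Arguments.
Unset Strict Implicit.
Unset Printing Implicit Defensive.

Import GRing.Theory.
Local Open Scope ring_scope.

(* A connected diagram on the sphere is a combinatorial map.  The four
   edge-ends at a crossing [c] are numbered counterclockwise, the understrand
   being formed by the ends 0 and 2 and the overstrand by the ends 1 and 3.  The
   corner [(c, i)] is the one between the ends [i] and [i + 1], so a pair
   [(c, i)], called a dart, names both an edge-end and a corner. *)
Definition rot (C : finType) (x : C * 'Z_4) : C * 'Z_4 := (x.1, x.2 + 1).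
Definition unrot (C : finType) (x : C * 'Z_4) : C * 'Z_4 := (x.1, x.2 - 1).
Definition opposite (C : finType) (x : C * 'Z_4) : C * 'Z_4 := (x.1, x.2 + 2).

(* From the corner [x], follow the end [rot x] to the other end of its edge,
   keeping the region on the right: this leads to the next corner of the same
   region, so that regions are orbits of [face_next]. *)
Definition face_next (C : finType) (mate : C * 'Z_4 -> C * 'Z_4)
  (x : C * 'Z_4) : C * 'Z_4 := mate (rot x).

Definition face_of (C : finType) (mate : C * 'Z_4 -> C * 'Z_4)
  (x : C * 'Z_4) : {set C * 'Z_4} := [set y | fconnect (face_next mate) x y].

(* [mate] exchanges the two ends of each edge.  There are twice as many edges as
   crossings, so [planar] is Euler's formula V - E + F = 2. *)
Record diagram := Diagram {
  crossing : finType;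
  mate : crossing * 'Z_4 -> crossing * 'Z_4;
  mate_involutive : involutive mate;
  mate_neq : forall x, mate x != x;
  connected : forall x y,
    connect [rel u v | (v == mate u) || (v == rot u)] x y;
  planar : #|[set face_of mate x | x : crossing * 'Z_4]| = (#|crossing| + 2)%N
}.

Definition dart (D : diagram) : finType := (crossing D * 'Z_4)%type.

Section Diagrams.
Variable D : diagram.

Definition region_of (x : dart D) : {set dart D} := face_of (@mate D) x.
Definition regions : {set {set dart D}} := [set region_of x | x : dart D].

(* Arcs are represented by their sets of edge-ends. *)
Definition same_arc_step : rel (dart D) :=
  [rel u v | (v == mate u) || (odd u.2 && (v == opposite u))].
Definition arc_of (x : dart D) : {set dart D} :=
  [set y | connect same_arc_step x y].
Definition arcs : {set {set dart D}} := [set arc_of x | x : dart D].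

(* Both under-ends of [c] contribute, hence 2 if the arc [a] contains both. *)
Definition coloring_entry (c : crossing D) (a : {set dart D}) : int :=
  ((c, 0) \in a)%:R + ((c, 2) \in a)%:R - 2 * ((c, 1) \in a)%:R.

(* The crossing-by-arc matrix of [coloring_entry] is, up to the signs of its
   rows, the Alexander matrix of the Wirtinger presentation at t = -1.  The gcd
   of its minors of order (number of arcs - 1), that is the generator of its
   first elementary ideal, is det(K) = |Delta_K(-1)|, the order of the first
   homology of the branched double cover (0 if this is infinite). *)
Definition link_det : nat :=
  \big[gcdn/0%N]_(f : {ffun 'I_#|arcs|.-1 -> crossing D})
  \big[gcdn/0%N]_(g : {ffun 'I_#|arcs|.-1 -> dart D})
    `|\det (\matrix_(i, j) coloring_entry (f i) (arc_of (g j)))|%N.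

Definition checkerboard (black : dart D -> bool) : Prop :=
  (forall x, black (face_next (@mate D) x) = black x) /\
  (forall x, black (rot x) = ~~ black x).

Variable black : dart D -> bool.

(* Rotated counterclockwise, the overstrand (ends 1 and 3) sweeps out the
   corners 1 and 3. *)
Definition mu (c : crossing D) : rat := if black (c, 1) then -1 else 1.

(* In what follows a colour is a boolean: [true] is black, [false] is white.
   [fst_corner col c] and its opposite are the two corners of colour [col]
   at [c]; the edge at [c] of the black (white) graph joins their regions. *)
Definition fst_corner (col : bool) (c : crossing D) : dart D :=
  if black (c, 0) == col then (c, 0) else (c, 1).
Definition edge_src (col : bool) c := region_of (fst_corner col c).
Definition edge_tgt (col : bool) c := region_of (opposite (fst_corner col c)).

Definition goeritz_entry (col : bool) (R S : {set dart D}) : rat :=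
  if R == S then
    - \sum_(c : crossing D | (edge_src col c != edge_tgt col c) &&
                ((edge_src col c == R) || (edge_tgt col c == R))) mu c
  else
    \sum_(c : crossing D | ((edge_src col c == R) && (edge_tgt col c == S)) ||
               ((edge_src col c == S) && (edge_tgt col c == R))) mu c.

Definition goeritz_matrix (col : bool) (n : nat) (r : 'I_n -> {set dart D}) :
  'M[rat]_n := \matrix_(i, j) goeritz_entry col (r i) (r j).

Definition coloring_matrix (n : nat) (c : 'I_n -> crossing D)
  (a : 'I_n -> {set dart D}) : 'M[rat]_n :=
  \matrix_(i, j) (mu (c i) * (coloring_entry (c i) (a j))%:~R).

(* The marked point lies on the edge of the end [p], between the regions with
   corners [p] and [unrot p]. *)
Definition marked_region (p : dart D) (col : bool) : {set dart D} :=
  if black p == col then region_of p else region_of (unrot p).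

Definition unmarked_regions (p : dart D) (col : bool) : {set {set dart D}} :=
  [set region_of x | x : dart D & black x == col] :\ marked_region p col.

(* [x c] is the chosen corner at [c]. *)
Definition kauffman_state (p : dart D) (x : crossing D -> 'Z_4) : Prop :=
  forall R, R \in regions ->
    #|[set c | (c, x c) \in R]| =
      if (R == marked_region p true) || (R == marked_region p false)
      then 0%N else 1%N.

Definition xi (x : crossing D -> 'Z_4) (c : crossing D) : rat :=
  (black (c, x c))%:R.

(* The overstrand separates the corners 1, 2 from the corners 3, 0, so the other
   corner on the same side as [i] is [3 - i]. *)
Definition edge_head (col : bool) (x : crossing D -> 'Z_4) (c : crossing D) :
  dart D := if black (c, x c) == col then (c, x c) else (c, 3 - x c).
Definition edge_tail (col : bool) (x : crossing D -> 'Z_4) (c : crossing D) :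
  dart D := opposite (edge_head col x c).

Definition degree (col : bool) (x : crossing D -> 'Z_4) (R : {set dart D}) :
  rat :=
  \sum_(c : crossing D)
    ((edge_tail col x c \in R)%:R - (edge_head col x c \in R)%:R).

(* In H_2(D), the surface Sigma is the double of the planar neighbourhood N(D) of
   D: a top and a bottom copy of N(D) glued along one circle per region (alpha_R,
   or delta_1 for the marked white region).  The alpha curves, delta_1 and the beta
   curves form a graph on Sigma.  Its vertices are the points where the beta curves
   meet the circles: [inl x] is the point of beta_c at the corner [x] of c, and
   [inr b] is the point of beta_p on the circle of the marked region of colour
   [b]. *)
Definition point : finType := (dart D + bool)%type.

Variable p : dart D.

(* Next point along a circle, keeping its region on the right and N(D) on the
   left.  The segments of the circles are indexed by their starting points. *)
Definition alpha_next (s : point) : point :=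
  match s with
  | inl x => if (rot x == p) || (rot x == mate p) then inr (black x)
             else inl (face_next (@mate D) x)
  | inr b => inl (if black p == b then p else mate p)
  end.

(* The other endpoint of the beta arc starting at a point, on the top: around an
   under-end of c, i.e. between the corners 0 and 3, or 1 and 2; and on the
   bottom: between opposite corners of c.  beta_p has one arc on each side. *)
Definition top_arc (s : point) : point :=
  match s with inl x => inl (x.1, 3 - x.2) | inr b => inr (~~ b) end.
Definition bottom_arc (s : point) : point :=
  match s with inl x => inl (opposite x) | inr b => inr (~~ b) end.

(* beta_c is oriented so that it visits the corners 0, 3, 1, 2 in this order, and
   beta_p so that it starts on the top at [inr true].  Like those of the circles,
   the beta arcs are indexed by their starting points. *)
Definition starts_on_top (s : point) : bool :=
  match s with inl x => (x.2 == 0) || (x.2 == 1) | inr b => b end.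
Definition beta_next (s : point) : point :=
  if starts_on_top s then top_arc s else bottom_arc s.

Definition on_delta1 (s : point) : bool :=
  match s with
  | inl x => region_of x == marked_region p false
  | inr b => ~~ b
  end.

(* [(s, true)] and [(s, false)] are the top and the bottom sides of the circle
   segment starting at [s]. *)
Definition side : finType := (point * bool)%type.

(* The graph cuts the top half into neighbourhoods of the arcs (the marked one
   being cut in two by beta_p).  In the bottom half, the first arcs and the arc of
   beta_p leave a disk, which the disjoint second arcs cut into smaller disks.
   The sides belonging to one disk are met in turn by walking along a circle
   segment and then along the beta arc starting at its endpoint; as this depends
   only on which points the bottom arcs join, the spanning tree, which tells which
   of the two bottom arcs of beta_c comes first, plays no further role.  Since
   delta_1 is not an alpha curve, the two sides of its segments lie in the same
   component of the complement of the alpha and beta curves. *)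
Definition same_region_step : rel side :=
  [rel u v |
     (v == ((if u.2 then top_arc else bottom_arc) (alpha_next u.1), u.2)) ||
     (on_delta1 u.1 && (v == (u.1, ~~ u.2)))].

(* Components of Sigma minus the alpha and beta curves, as sets of sides. *)
Definition hregion (u : side) : {set side} :=
  [set v | connect same_region_step u v].

(* The circle segment starting at [unrot x] runs along the clockwise side of the
   end [x], which has the region with corner [x] on its other side.  In both
   definitions the regions in the union are in fact equal. *)
Definition arc_region (a : {set dart D}) : {set side} :=
  \bigcup_(x in a) hregion (inl (unrot x), true).
Definition face_region (v : {set dart D}) : {set side} :=
  \bigcup_(x in v) hregion (inl (unrot x), false).

(* On the curve through [u], the chain [d] is the arc from [u] to [v] plus a
   rational multiple of the whole curve. *)
Definition joins (next : point -> point) (u v : point) (d : point -> rat) :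
  Prop :=
  exists r : rat, forall s, fconnect next u s ->
    d s = (s \in traject next u (findex next u v))%:R + r.

(* Left and right when Sigma is oriented as the boundary of U, i.e.
   counterclockwise on the top seen from above.  The circle segments have the top
   on their left. *)
Definition beta_left (s : point) : {set side} :=
  if starts_on_top s then hregion (beta_next s, true) else hregion (s, false).
Definition beta_right (s : point) : {set side} :=
  if starts_on_top s then hregion (s, true) else hregion (beta_next s, false).

Definition orientation_sign (outward : bool) : rat := if outward then 1 else -1.

(* [outward] tells whether Sigma is oriented as the boundary of U; left and right
   are exchanged otherwise.  [da] and [db] are the coefficients of the 1-cycle on
   the circle segments (0 on delta_1) and on the beta arcs. *)
Definition is_domain (outward : bool) (x y : crossing D -> 'Z_4)
  (q : {set side} -> rat) : Prop :=
  q (hregion (inr true, true)) = 0 /\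
  exists da db : point -> rat,
    [/\ (forall s, on_delta1 s -> da s = 0),
        joins alpha_next (inr true) (inr true) da /\
        (forall c c', region_of (c, x c) = region_of (c', y c') ->
           joins alpha_next (inl (c, x c)) (inl (c', y c')) da),
        joins beta_next (inr true) (inr true) db /\
        (forall c, joins beta_next (inl (c, y c)) (inl (c, x c)) db),
        (forall s, orientation_sign outward *
           (q (hregion (s, true)) - q (hregion (s, false))) = da s) &
        (forall s, orientation_sign outward *
           (q (beta_left s) - q (beta_right s)) = db s)].

End Diagrams.

Definition enumerates (T : finType) (n : nat) (f : 'I_n -> T) (S : {set T}) :
  Prop := injective f /\ [set f i | i : 'I_n] = S.

(* Main.v *)
Require Import Defs.
From mathcomp Require Import all_boot all_order all_algebra.
From mathcomp Require Import ring lra zify.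

Set Implicit Arguments.
Unset Strict Implicit.
Unset Printing Implicit Defensive.

Import GRing.Theory.
Local Open Scope ring_scope.

(** The coefficients of the domain on the regions of arcs and faces satisfy, at
    each crossing [c], four equations: across the four arcs of [beta_c] they jump
    by the coefficients of the boundary.  The alternating sum of the two top
    equations is a row of the coloring system.  In a row of the Goeritz system,
    the bottom equations at the corners of a region [R] give the degrees, up to a
    sum of differences of arc coefficients that telescopes around [R] and a
    count of the corners of [x] and [y] in [R].  The region of the basepoint
    contains the marked arc and the marked faces: on the bottom, [beta_p] merges
    the cyclic walks around the two marked faces.

    If [det K <> 0] then Fox colorings are constant, so the coloring matrix is
    invertible.  It follows that Dehn colorings vanishing on the marked regions
    are zero; by Euler's formula the Dehn system is square, hence its transpose
    is injective too, and a vector in the kernel of a Goeritz matrix yields a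
    vector in the kernel of this transpose: the differences across the
    crossings, which therefore vanish. *)

(* [rot] would otherwise denote the rotation of sequences. *)
Local Notation rot := Defs.rot.

(** * Linear algebra and finite dynamics *)

Lemma Z4P (P : 'Z_4 -> Prop) : P 0 -> P 1 -> P 2 -> P 3 -> forall i, P i.
Proof.
move=> P0 P1 P2 P3 [[|[|[|[|//]]]] lti].
- by have -> : Ordinal lti = 0 by apply/val_inj.
- by have -> : Ordinal lti = 1 by apply/val_inj.
- by have -> : Ordinal lti = 2 by apply/val_inj.
- by have -> : Ordinal lti = 3 by apply/val_inj.
Qed.

Lemma sum_Z4 (V : nmodType) (F : 'Z_4 -> V) :
  \sum_i F i = F 0 + F 1 + F 2 + F 3.
Proof.
rewrite !big_ord_recr big_ord0 /= add0r.
by congr (F _ + F _ + F _ + F _); apply/val_inj.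
Qed.

Section LinearAlgebra.
Variable F : fieldType.

(** A square matrix is invertible once its kernel is trivial; the rows of the left kernel of the
    transpose are the vectors to which the hypothesis applies. *)
Lemma unitmx_of_inj n (A : 'M[F]_n) :
  (forall v : 'cV_n, A *m v = 0 -> v = 0) -> A \in unitmx.
Proof.
move=> injA; rewrite -unitmx_tr -row_free_unit -kermx_eq0.
apply/eqP/row_matrixP => i; rewrite row0 -[LHS]trmxK.
rewrite [X in X^T]injA ?trmx0 //; apply: trmx_inj.
by rewrite trmx_mul trmxK -row_mul mulmx_ker row0 trmx0.
Qed.

(** The rows in [I] and the columns in [A] form a square matrix, so that a trivial right kernel
    means full rank, hence a trivial left kernel. Vectors indexed by [A] are encoded as functions on
    [J] vanishing outside [A]. *)
Lemma left_kernel_of_right_kernel (I J : finType) (A : {set J})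
    (M : I -> J -> F) : #|I| = #|A| ->
  (forall v : J -> F, (forall j, j \notin A -> v j = 0) ->
     (forall i, \sum_j M i j * v j = 0) -> forall j, v j = 0) ->
  forall u : I -> F, (forall j, j \in A -> \sum_i u i * M i j = 0) ->
    forall i, u i = 0.
Proof.
move=> cardIA injM u uM i.
pose N : 'M[F]_(#|I|, #|A|) := \matrix_(i, j) M (enum_val i) (enum_val j).
have sumA (G : J -> F) : \sum_(j in A) G j = \sum_(j < #|A|) G (enum_val j).
  by rewrite big_enum_val.
have sumI (G : I -> F) : \sum_i G i = \sum_(i < #|I|) G (enum_val i).
  by rewrite -big_enum_val; apply: eq_bigl.
have freeN : row_free N^T.
  rewrite -kermx_eq0; apply/eqP/row_matrixP => r; rewrite row0.
  have : row r (kermx N^T) *m N^T = 0 by rewrite -row_mul mulmx_ker row0.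
  move: (row r _) => w wN.
  (* The extension of [w] by 0 outside [A]. *)
  pose v j := \sum_(t < #|A|) w 0 t * (enum_val t == j)%:R.
  have vE t : v (enum_val t) = w 0 t.
    rewrite /v (bigD1 t) //= eqxx mulr1 big1 ?addr0 // => t' /negPf ne.
    by rewrite (inj_eq enum_val_inj) ne mulr0.
  have v0 j : j \notin A -> v j = 0.
    move=> nAj; rewrite /v big1 // => t _; case: eqP => [E|_]; last by rewrite mulr0.
    by case/negP: nAj; rewrite -E enum_valP.
  have vM j : v j = 0.
    apply: injM => // {}i; rewrite (bigID (mem A)) /= [X in _ + X]big1 ?addr0.
      rewrite sumA; move/rowP/(_ (enum_rank i)): wN.
      rewrite !mxE => wN; rewrite -[RHS]wN; apply: eq_bigr => t _.
      by rewrite vE !mxE enum_rankK mulrC.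
    by move=> j' /v0 ->; rewrite mulr0.
  by apply/rowP => t; rewrite mxE -vE vM.
have : row_free N.
  by move: freeN; rewrite /row_free mxrank_tr => /eqP ->; apply/eqP.
rewrite -kermx_eq0 => /eqP kerN.
have /sub_kermxP : (\row_r u (enum_val r)) *m N = 0.
  apply/rowP => t; rewrite !mxE -[RHS](uM (enum_val t) (enum_valP t)) sumI.
  by apply: eq_bigr => r _; rewrite !mxE.
rewrite kerN submx0 => /eqP/rowP/(_ (enum_rank i)).
by rewrite !mxE enum_rankK.
Qed.

Lemma sum_enumerates (T : finType) n (r : 'I_n -> T) (A : {set T})
    (V : nmodType) (G : T -> V) :
  enumerates r A -> \sum_i G (r i) = \sum_(t in A) G t.
Proof. by case=> injr <-; rewrite big_imset //= => i j _ _; apply: injr. Qed.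

End LinearAlgebra.

(** * Symmetry of reachability and segments of orbits *)

Section Connectivity.

(** Meant for relations whose steps are undone by a path rather than by a single step, such as a
    step of a permutation. *)
Lemma connect_pre_sym (T : finType) (e : rel T) :
  (forall u v, e u v -> connect e v u) -> connect_sym e.
Proof.
move=> sym_e; suff imp u v : connect e u v -> connect e v u.
  by move=> u v; apply/idP/idP; apply: imp.
case/connectP=> s; elim: s u => [|t s IH] u /=; first by move=> _ ->.
case/andP=> /sym_e tu /IH{}IH /IH; move/connect_trans; exact.
Qed.

Lemma connect_ind_r (T : finType) (e : rel T) (P : T -> Prop) (u v : T) :
  P u -> (forall t t', P t -> e t t' -> P t') -> connect e u v -> P v.
Proof.
move=> Pu step /connectP[s]; elim: s u Pu => [|t s IH] u Pu /=.
  by move=> _ ->.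
by case/andP=> /(step _ _ Pu)/IH.
Qed.

(** The boundary of a segment of a cycle: counted from [u], a point lies in the segment when its
    index is smaller than that of [v]. If [u = v] the segment is empty and the two terms on the
    right cancel. *)
Lemma traject_step (T : finType) (f : T -> T) (u v s : T) : injective f ->
    fconnect f u v -> fconnect f u s ->
  (f s \in traject f u (findex f u v))%:R - (s \in traject f u (findex f u v))%:R
    = (f s == u)%:R - (f s == v)%:R :> rat.
Proof.
move=> injf uv us; set k := findex f u v.
have lek : (k < fingraph.order f u)%N by apply: findex_max.
have memT t : fconnect f u t -> (t \in traject f u k) = (findex f u t < k)%N.
  move=> ut; rewrite -(take_traject f u (ltnW lek)).
  by rewrite in_take ?/findex // -fconnect_orbit.
have ufs : fconnect f u (f s) by apply: connect_trans us (fconnect1 _ _).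
rewrite !memT //.
have lti : (findex f u s < fingraph.order f u)%N by apply: findex_max.
have fsE : f s = iter (findex f u s).+1 f u by rewrite iterS iter_findex.
have eqv : (f s == v) = (findex f u (f s) == k).
  apply/eqP/eqP => [->//|E].
  by rewrite -(iter_findex ufs) E iter_findex.
have equ : (f s == u) = (findex f u (f s) == 0%N).
  apply/eqP/eqP => [->|E]; first by rewrite findex0.
  by rewrite -(iter_findex ufs) E.
rewrite eqv equ.
(* Either [s] is the last point of the orbit and [f s] is [u] again, or the index grows by one. *)
move: lti; rewrite leq_eqVlt => /orP[/eqP ordE|lti].
  have -> : findex f u (f s) = 0%N by rewrite fsE ordE iter_order // findex0.
  rewrite [(findex f u s < k)%N]ltnNge.
  have -> : (k <= findex f u s)%N by rewrite -ltnS ordE.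
  by rewrite eqxx; case: (k) => [|k'] //=; rewrite subrr.
have -> : findex f u (f s) = (findex f u s).+1 by rewrite fsE findex_iter.
set i := findex f u s; rewrite /=.
by case: (ltngtP i.+1 k) => [ik|ik|ik]; have := ik; case: (ltnP i k) => //; lia.
Qed.

End Connectivity.

(** * Darts, regions and arcs *)

Section Darts.
Variable D : diagram.
Implicit Types x y : dart D.

Lemma dart_ind (P : dart D -> Prop) :
  (forall c, [/\ P (c, 0), P (c, 1), P (c, 2) & P (c, 3)]) -> forall x, P x.
Proof. by move=> Pc [c]; apply: Z4P; have [] := Pc c. Qed.

Lemma sum_dart (V : nmodType) (F : dart D -> V) :
  \sum_x F x = \sum_c (F (c, 0) + F (c, 1) + F (c, 2) + F (c, 3)).
Proof.
under [RHS]eq_bigr => c _ do rewrite -(sum_Z4 (fun i => F (c, i))).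
by rewrite pair_bigA; apply: eq_bigr => -[].
Qed.

Lemma sum_dart_in (V : nmodType) (F : dart D -> V) (R : {set dart D}) :
  \sum_(x in R) F x = \sum_c (F (c, 0) *+ ((c, 0) \in R) +
    F (c, 1) *+ ((c, 1) \in R) + F (c, 2) *+ ((c, 2) \in R) +
    F (c, 3) *+ ((c, 3) \in R)).
Proof.
rewrite big_mkcond -(sum_dart (fun x => F x *+ (x \in R))).
by apply: eq_bigr => x _; case: (x \in R).
Qed.

Lemma mateK : involutive (@mate D). Proof. exact: mate_involutive. Qed.
Lemma dart_rotK : cancel (@Defs.rot (crossing D)) (@unrot _).
Proof. by move=> [c i]; rewrite /unrot /Defs.rot /= addrK. Qed.
Lemma dart_unrotK : cancel (@unrot (crossing D)) (@rot _).
Proof. by move=> [c i]; rewrite /unrot /Defs.rot /= subrK. Qed.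
Lemma oppositeE x : opposite x = rot (rot x).
Proof.
case: x => c i; rewrite /opposite /Defs.rot /= -addrA.
by congr (_, _ + _); apply/eqP.
Qed.
Lemma oppositeK : involutive (@opposite (crossing D)).
Proof.
move=> [c i]; rewrite /opposite /= -addrA.
by rewrite (_ : 2 + 2 = 0 :> 'Z_4) ?addr0 //; apply/eqP.
Qed.
Lemma rot_opposite x : rot (opposite x) = unrot x.
Proof. by apply: (can_inj dart_rotK); rewrite -oppositeE oppositeK dart_unrotK. Qed.

Lemma unrot_corners (c : crossing D) :
  ((unrot (c, 0) = (c, 3)) * (unrot (c, 1) = (c, 0)) *
   (unrot (c, 2) = (c, 1)) * (unrot (c, 3) = (c, 2)))%type.
Proof. by do !split; congr (_, _); apply/eqP. Qed.

Lemma rot_corners (c : crossing D) :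
  ((rot (c, 0) = (c, 1)) * (rot (c, 1) = (c, 2)) *
   (rot (c, 2) = (c, 3)) * (rot (c, 3) = (c, 0)))%type.
Proof. by do !split; congr (_, _); apply/eqP. Qed.

Lemma opposite_corners (c : crossing D) :
  ((opposite (c, 0) = (c, 2)) * (opposite (c, 1) = (c, 3)) *
   (opposite (c, 2) = (c, 0)) * (opposite (c, 3) = (c, 1)))%type.
Proof. by do !split; congr (_, _); apply/eqP. Qed.

Lemma face_next_inj : injective (face_next (@mate D)).
Proof. exact: (inj_comp (inv_inj mateK) (can_inj dart_rotK)). Qed.

Lemma mem_region x : x \in region_of x.
Proof. by rewrite inE connect0. Qed.

Lemma region_of_eq x y : (region_of x == region_of y) = (y \in region_of x).
Proof.
have sym : connect_sym (frel (face_next (@mate D))).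
  exact: fconnect_sym face_next_inj.
apply/eqP/idP => [->|]; first exact: mem_region.
rewrite inE => xy; apply/setP => z; rewrite !inE.
exact: same_connect.
Qed.

Lemma region_of_mem x y : y \in region_of x -> region_of y = region_of x.
Proof. by rewrite -region_of_eq => /eqP. Qed.

Lemma region_face_next x : region_of (face_next (@mate D) x) = region_of x.
Proof. by apply: region_of_mem; rewrite inE fconnect1. Qed.

Lemma region_mate x : region_of (mate x) = region_of (unrot x).
Proof. by rewrite -(region_face_next (unrot x)) /face_next dart_unrotK. Qed.

Lemma region_unrot_mate x : region_of (unrot (mate x)) = region_of x.
Proof. by rewrite -region_mate mateK. Qed.

Lemma mem_regions x : region_of x \in regions D.
Proof. exact: imset_f. Qed.

Lemma sum_region_face_next (V : nmodType) x (F : dart D -> V) :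
  \sum_(y in region_of x) F (face_next (@mate D) y) = \sum_(y in region_of x) F y.
Proof.
rewrite [RHS](reindex_inj face_next_inj) /=; apply: eq_bigl => y.
by rewrite -!region_of_eq region_face_next.
Qed.

Lemma dart_connected (P : dart D -> Prop) x :
  P x -> (forall y, P y -> P (mate y)) -> (forall y, P y -> P (rot y)) ->
  forall y, P y.
Proof.
move=> Px Pm Pr y; apply: connect_ind_r (connected x y) => // u v Pu.
by case/orP=> /eqP ->; auto.
Qed.

End Darts.

Section Colours.
Variables (D : diagram) (black : dart D -> bool).
Hypothesis hblack : checkerboard black.

Lemma black_rot x : black (rot x) = ~~ black x.
Proof. by case: hblack. Qed.

Lemma black_corners c :
  [/\ black (c, 1) = ~~ black (c, 0), black (c, 2) = black (c, 0) &
      black (c, 3) = ~~ black (c, 0)].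
Proof.
have E (i : 'Z_4) : black (c, i + 1) = ~~ black (c, i) by apply: (black_rot (c, i)).
split; first by rewrite -(E 0) add0r.
  by rewrite (_ : 2 = 0 + 1 + 1 :> 'Z_4) ?E ?negbK //; apply/eqP.
by rewrite (_ : 3 = 0 + 1 + 1 + 1 :> 'Z_4) ?E ?negbK //; apply/eqP.
Qed.

Lemma black_unrot x : black (unrot x) = ~~ black x.
Proof. by rewrite -[x in RHS]dart_unrotK black_rot negbK. Qed.

Lemma black_opposite x : black (opposite x) = black x.
Proof. by rewrite oppositeE !black_rot negbK. Qed.

Lemma black_region x y : y \in region_of x -> black y = black x.
Proof.
rewrite inE; apply: (@connect_ind_r _ _ (fun z => black z = black x)) => //.
by move=> u v <- /eqP <-; case: hblack => ->.
Qed.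

Lemma eq_region_black x y : region_of x = region_of y -> black x = black y.
Proof. by move=> E; apply: black_region; rewrite -E mem_region. Qed.

Lemma black_mate x : black (mate x) = ~~ black x.
Proof. by rewrite -black_unrot; apply: eq_region_black; rewrite region_mate. Qed.

Lemma mu_black c : mu black c = if black (c, 0) then 1 else -1.
Proof. by rewrite /mu; have [-> _ _] := black_corners c; case: black. Qed.

End Colours.

Section Arcs.
Variable D : diagram.
Implicit Types (x y : dart D) (a : {set dart D}).

Lemma same_arc_step_sym : symmetric (@same_arc_step D).
Proof.
move=> x y; rewrite /same_arc_step /=; congr (_ || _).
  by rewrite eq_sym -(inj_eq (inv_inj (@mateK D))) mateK.
have oddO (z : dart D) : odd (opposite z).2 = odd z.2.
  by case: z => c; apply: Z4P.
by apply/andP/andP => -[ox /eqP E]; rewrite E oddO oppositeK ox eqxx.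
Qed.

Lemma mem_arc x : x \in arc_of x.
Proof. by rewrite inE connect0. Qed.

Lemma arc_of_eq x y : (arc_of x == arc_of y) = (y \in arc_of x).
Proof.
have sym := sym_connect_sym same_arc_step_sym.
apply/eqP/idP => [->|]; first exact: mem_arc.
rewrite inE => xy; apply/setP => z; rewrite !inE.
exact: same_connect.
Qed.

Lemma arc_of_mem x y : y \in arc_of x -> arc_of y = arc_of x.
Proof. by rewrite -arc_of_eq => /eqP. Qed.

Lemma arc_mate x : arc_of (mate x) = arc_of x.
Proof.
apply: arc_of_mem; rewrite inE; apply: connect1.
by rewrite /same_arc_step /= eqxx.
Qed.

Lemma arc_opposite x : odd x.2 -> arc_of (opposite x) = arc_of x.
Proof.
move=> ox; apply: arc_of_mem; rewrite inE; apply: connect1.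
by rewrite /same_arc_step /= ox eqxx orbT.
Qed.

Lemma arc_overstrand c : arc_of (c, 3) = arc_of ((c, 1) : dart D).
Proof.
by rewrite -(arc_opposite (x := (c, 1))) // opposite_corners.
Qed.

Lemma mem_arcs x : arc_of x \in arcs D.
Proof. exact: imset_f. Qed.

Lemma arc_of_arcs a x : a \in arcs D -> x \in a -> a = arc_of x.
Proof. by case/imsetP=> y _ -> /arc_of_mem ->. Qed.

Lemma mem_arc_arcs a x : a \in arcs D -> (x \in a) = (a == arc_of x).
Proof. by case/imsetP=> y _ ->; rewrite arc_of_eq. Qed.

(** Each end lies on exactly one arc, so a row of the coloring matrix expresses the Fox relation at
    [c], up to the sign [mu]. *)
Lemma sum_coloring_entry (F : numFieldType) c (h : {set dart D} -> F) :
  \sum_(a in arcs D) (coloring_entry c a)%:~R * h a =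
  h (arc_of (c, 0)) + h (arc_of (c, 2)) - 2 * h (arc_of (c, 1)).
Proof.
have memE i : \sum_(a in arcs D) ((c, i) \in a)%:R * h a = h (arc_of (c, i)).
  rewrite (bigD1 (arc_of (c, i))) ?mem_arcs //= mem_arc mul1r.
  rewrite big1 ?addr0 // => a /andP[ha /negPf na].
  by rewrite mem_arc_arcs // na mul0r.
rewrite -!memE mulr_sumr -sumrN -!big_split /=; apply: eq_bigr => a _.
rewrite /coloring_entry !rmorphD rmorphN rmorphM /= !rmorph_nat; ring.
Qed.

End Arcs.

(** * Invertibility of the coloring and Goeritz matrices *)

Section Fox.
Variable D : diagram.

(** A gcd of zeros is 0. *)
Lemma link_det_minor : link_det D != 0%N ->
  exists f : 'I_#|arcs D|.-1 -> crossing D,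
  exists g : 'I_#|arcs D|.-1 -> dart D,
    \det (\matrix_(i, j) coloring_entry (f i) (arc_of (g j))) != 0.
Proof.
move=> det_neq0.
case: (pickP (fun fg : {ffun 'I_#|arcs D|.-1 -> crossing D} *
                       {ffun 'I_#|arcs D|.-1 -> dart D} =>
  \det (\matrix_(i, j) coloring_entry (fg.1 i) (arc_of (fg.2 j))) != 0)).
  by case=> f g nz; exists f, g.
move=> all0; case/eqP: det_neq0; rewrite /link_det big1 // => f _.
by rewrite big1 // => g _; have /negbFE/eqP -> := all0 (f, g).
Qed.

(** The columns of a nonzero minor are distinct, so they miss a single arc [a]. The differences
    [h b - h a] again satisfy the Fox relations and vanish at [a], hence the minor kills them. *)
Lemma fox_coloring_constant (h : {set dart D} -> rat) : link_det D != 0%N ->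
  (forall c : crossing D,
     h (arc_of (c, 0)) + h (arc_of (c, 2)) = 2 * h (arc_of (c, 1))) ->
  forall x y, h (arc_of x) = h (arc_of y).
Proof.
move=> /link_det_minor[f [g]]; set N := \matrix_(i, j) _ => detN foxh x y.
have inj_g : injective (fun j => arc_of (g j)).
  move=> j1 j2 eq_g; apply/eqP; apply: contraNT detN => ne.
  rewrite -det_tr; apply/eqP/(determinant_alternate ne) => i.
  by rewrite !mxE eq_g.
pose I := [set arc_of (g j) | j : 'I_#|arcs D|.-1].
have subI : I \subset arcs D by apply/subsetP => _ /imsetP[j _ ->]; apply: mem_arcs.
have [a Da] : exists a, arcs D :\: I = [set a].
  have cardI : #|I| = #|arcs D|.-1 by rewrite /I card_imset // card_ord.
  apply/cards1P; rewrite cardsD (setIidPr subI) cardI.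
  have : (0 < #|arcs D|)%N by apply/card_gt0P; exists (arc_of x); apply: mem_arcs.
  by case: #|_| => // n _; rewrite subSnn.
have eqa b : b \in arcs D -> b \in I \/ b = a.
  move=> bD; case: (boolP (b \in I)) => bI; first by left.
  by right; apply/set1P; rewrite -Da inE bI.
have aD : a \in arcs D by have := set11 a; rewrite -Da => /setDP[].
have sumI F : F a = 0 -> \sum_j F (arc_of (g j)) = \sum_(b in arcs D) F b :> rat.
  move=> Fa; rewrite -(big_imset (h := fun j => arc_of (g j))) /=.
    2: by move=> ? ? _ _ /inj_g.
  by rewrite [RHS](big_setID I) /= (setIidPr subI) Da big_set1 Fa [RHS]addr0.
pose v : 'cV[rat]_#|arcs D|.-1 := \col_j (h (arc_of (g j)) - h a).
have unitN : map_mx (intr : int -> rat) N \in unitmx.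
  by rewrite unitmxE det_map_mx unitfE intr_eq0.
have v0 : v = 0.
  rewrite -[v](mulKmx unitN) (_ : _ *m v = 0) ?mulmx0 //.
  apply/colP => i; rewrite !mxE.
  pose F b := (coloring_entry (f i) b)%:~R * (h b - h a).
  rewrite (eq_bigr (fun j => F (arc_of (g j)))); last by move=> j _; rewrite !mxE.
  rewrite sumI; last by rewrite /F subrr mulr0.
  rewrite (sum_coloring_entry _ (fun b => h b - h a)).
  by have := foxh (f i); lra.
suff eqh b : b \in arcs D -> h b = h a by rewrite !eqh ?mem_arcs.
case/eqa=> [/imsetP[j _ ->]|-> //].
by move/colP/(_ j): v0; rewrite !mxE => /eqP; rewrite subr_eq0 => /eqP.
Qed.

Variable black : dart D -> bool.
Hypothesis hblack : checkerboard black.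

(* With the sign of the colour on a fixed side of each edge-end, the two ends of
   an edge cancel, whereas at each crossing one finds the relation of the row. *)
Lemma coloring_rows_relation (h : {set dart D} -> rat) :
  \sum_c mu black c *
    (h (arc_of (c, 0)) + h (arc_of (c, 2)) - 2 * h (arc_of (c, 1))) = 0.
Proof.
pose G x : rat := (if black x then 1 else -1) * h (arc_of x).
have GN : \sum_x G x = - \sum_x G x.
  rewrite [LHS](reindex_inj (inv_inj (@mateK D))) -sumrN; apply: eq_bigr => x _.
  by rewrite /G arc_mate (black_mate hblack); case: black; rewrite /=; ring.
suff <- : \sum_x G x = \sum_c mu black c *
    (h (arc_of (c, 0)) + h (arc_of (c, 2)) - 2 * h (arc_of (c, 1))) by lra.
rewrite sum_dart; apply: eq_bigr => c _.
rewrite /G arc_overstrand (mu_black hblack); have [-> -> ->] := black_corners hblack c.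
by case: (black _); rewrite /=; ring.
Qed.

(** A kernel vector, extended by 0 to the marked arc, is a Fox coloring; it is constant, hence 0. *)
Lemma coloring_matrix_unit p c0 k (c : 'I_k -> crossing D)
    (a : 'I_k -> {set dart D}) : link_det D != 0%N ->
  enumerates c [set~ c0] -> enumerates a (arcs D :\ arc_of p) ->
  coloring_matrix black c a \in unitmx.
Proof.
move=> hdet [injc imc] ha; apply: unitmx_of_inj => v Av0.
have [inja ima] := ha.
have aA j : a j \in arcs D :\ arc_of p by rewrite -ima imset_f.
pose h b := \sum_j v j 0 * (a j == b)%:R.
have hE j : h (a j) = v j 0.
  rewrite /h (bigD1 j) //= eqxx mulr1 big1 ?addr0 // => i /negPf ne.
  by rewrite (inj_eq inja) ne mulr0.
have hp : h (arc_of p) = 0.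
  rewrite /h big1 // => j _; case: eqP => [E|]; rewrite ?mulr0 //.
  by have := aA j; rewrite E !inE eqxx.
pose row c := h (arc_of (c, 0)) + h (arc_of (c, 2)) - 2 * h (arc_of (c, 1)).
have muU d : mu black d != 0 by rewrite /mu; case: black.
have row_ne d : d != c0 -> row d = 0.
  move=> ne; have : d \in [set~ c0] by rewrite !inE.
  rewrite -imc => /imsetP[i _ ->]; apply: (mulfI (muU (c i))).
  rewrite /row -sum_coloring_entry (big_setD1 _ (mem_arcs p)) /= hp mulr0 add0r.
  rewrite -(sum_enumerates (fun b => _ * h b) ha) mulr0.
  move/colP/(_ i): Av0; rewrite !mxE => Av0; rewrite -[RHS]Av0.
  by rewrite mulr_sumr; apply: eq_bigr => j _; rewrite !mxE hE mulrA.
(* The relation at the marked crossing follows from all the others by [coloring_rows_relation]. *)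
have row0 d : row d = 0.
  have [->|/row_ne//] := eqVneq d c0; apply: (mulfI (muU c0)).
  rewrite mulr0 -[RHS](coloring_rows_relation h) (bigD1 c0) //=.
  rewrite [X in _ = _ + X]big1 ?addr0 //.
  by move=> e /row_ne; rewrite /row => ->; rewrite mulr0.
apply/colP => j; rewrite mxE -hE -hp.
case/setD1P: (aA j) => _ /imsetP[x _ ->]; apply: fox_coloring_constant => // d.
by apply/eqP; rewrite -subr_eq0; apply/eqP; apply: row0.
Qed.

End Fox.

(** * Dehn colorings and the kernel of a Goeritz matrix *)

Section Goeritz.
Variables (D : diagram) (black : dart D -> bool) (p : dart D).
Hypothesis hblack : checkerboard black.
Hypothesis hdet : link_det D != 0%N.

Definition all_unmarked : {set {set dart D}} :=
  regions D :\ region_of p :\ region_of (unrot p).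

Lemma region_unrot_neq (x : dart D) : region_of (unrot x) != region_of x.
Proof.
apply/eqP => /(eq_region_black hblack); rewrite (black_unrot hblack).
by case: black.
Qed.

(** Euler's formula gives two regions more than crossings, and the two marked regions are distinct
    because their colours differ. *)
Lemma card_all_unmarked : #|all_unmarked| = #|crossing D|.
Proof.
have h1 : region_of p \in regions D by apply: mem_regions.
have h2 : region_of (unrot p) \in regions D :\ region_of p.
  by rewrite !inE region_unrot_neq mem_regions.
have := planar D; rewrite -/(regions D).
rewrite (cardsD1 (region_of p)) h1 (cardsD1 (region_of (unrot p))) h2.
by rewrite -/all_unmarked add1n add1n addn2 => -[].
Qed.

Lemma sum_mem_region (F : {set dart D} -> rat) (x : dart D) :
  \sum_(R in regions D) (x \in R)%:R * F R = F (region_of x).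
Proof.
rewrite (bigD1 (region_of x)) ?mem_regions //= mem_region mul1r.
rewrite big1 ?addr0 // => R /andP[/imsetP[y _ ->]].
by rewrite region_of_eq => /negPf ->; rewrite mul0r.
Qed.

(* A Dehn colouring gives the Fox colouring whose value on an edge is the sum of
   the values on both sides. *)
Lemma dehn_coloring_trivial (F : {set dart D} -> rat) :
  (forall c : crossing D, F (region_of (c, 0)) + F (region_of (c, 1)) =
     F (region_of (c, 2)) + F (region_of (c, 3))) ->
  F (region_of p) = 0 -> F (region_of (unrot p)) = 0 ->
  forall x, F (region_of x) = 0.
Proof.
move=> dehnF Fp Fp'.
pose g (x : dart D) : rat := F (region_of x) + F (region_of (unrot x)).
have gm x : g (mate x) = g x.
  by rewrite /g region_mate region_unrot_mate addrC.
(* The Dehn relation says precisely that [g] agrees on the two over-ends, so [g] descends to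
   arcs. *)
have go (x : dart D) : odd x.2 -> g (opposite x) = g x.
  case: x => c; apply: Z4P => // _;
    by rewrite /g opposite_corners !unrot_corners; have := dehnF c; lra.
have g_arc x y : y \in arc_of x -> g y = g x.
  rewrite inE; apply: (@connect_ind_r _ _ (fun z => g z = g x)) => // u w <-.
  by case/orP=> [/eqP -> // | /andP[ou /eqP ->]]; apply: go.
(* Any representative will do; the default 0 is never taken, since arcs are nonempty. *)
pose h (a : {set dart D}) : rat := if [pick x in a] is Some x then g x else 0.
have hE x : h (arc_of x) = g x.
  rewrite /h; case: pickP => [y /g_arc //|/(_ x)]; by rewrite mem_arc.
have g0 x : g x = 0.
  have <- : g p = 0 by rewrite /g Fp Fp' addr0.
  rewrite -!hE; apply: fox_coloring_constant => // c.
  by rewrite !hE /g !unrot_corners; have := dehnF c; lra.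
(* The values on the two sides of every edge now add up to 0, so that vanishing spreads from [p] to
   all regions. *)
apply: (dart_connected (x := p)) => // y.
  by move=> Fy; have := g0 y; rewrite /g Fy add0r region_mate.
by move=> Fy; have := g0 (rot y); rewrite /g dart_rotK Fy addr0.
Qed.

Definition dehn_entry (c : crossing D) (R : {set dart D}) : rat :=
  ((c, 0) \in R)%:R + ((c, 1) \in R)%:R - ((c, 2) \in R)%:R - ((c, 3) \in R)%:R.

Lemma dehn_left_kernel (u : crossing D -> rat) :
  (forall R, R \in all_unmarked -> \sum_c u c * dehn_entry c R = 0) ->
  forall c, u c = 0.
Proof.
apply: left_kernel_of_right_kernel; first by rewrite card_all_unmarked.
move=> v v0 rows R; case: (boolP (R \in all_unmarked)) => [|/v0//].
case/setD1P=> _ /setD1P[_ /imsetP[x _ ->]].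
have vp : v (region_of p) = 0 by apply: v0; rewrite !inE eqxx andbF.
have vp' : v (region_of (unrot p)) = 0 by apply: v0; rewrite !inE eqxx.
apply: dehn_coloring_trivial => // c; have := rows c.
rewrite (bigID (mem (regions D))) /= [X in _ + X]big1 ?addr0; last first.
  by move=> S nS; rewrite v0 ?mulr0 // !inE (negPf nS) !andbF.
move=> rc; apply/eqP; rewrite -subr_eq0 -!(sum_mem_region v) -!big_split -sumrB /=.
by apply/eqP; rewrite -[RHS]rc; apply: eq_bigr => S _; rewrite /dehn_entry; ring.
Qed.

(** A single formula for both cases; for a loop at [R = S] the first two products cancel the
    diagonal term. *)
Lemma goeritz_entryE col R S : goeritz_entry black col R S =
  \sum_c mu black c *
    ((edge_src black col c == R)%:R * (edge_tgt black col c == S)%:R +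
     (edge_src black col c == S)%:R * (edge_tgt black col c == R)%:R -
     (R == S)%:R *
       ((edge_src black col c == R)%:R + (edge_tgt black col c == R)%:R)).
Proof.
rewrite /goeritz_entry; have [<-|neRS] := eqVneq R S.
  rewrite -sumrN big_mkcond; apply: eq_bigr => c _ /=.
  have [->|] := eqVneq (edge_src _ _ c) R.
    by rewrite eq_sym; case: eqP => _ /=; ring.
  have [->|_] := eqVneq (edge_tgt _ _ c) R; first by move=> -> /=; ring.
  by rewrite andbF => _ /=; ring.
rewrite big_mkcond; apply: eq_bigr => c _ /=.
have [->|_] := eqVneq (edge_src _ _ c) R.
  by rewrite (negPf neRS) /= orbF; case: eqP => _ /=; ring.
by case: (edge_src _ _ c == S); case: (edge_tgt _ _ c == R) => /=; ring.
Qed.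


Lemma sum_unmarked_regions col (F : {set dart D} -> rat) :
    F (marked_region black p col) = 0 ->
  \sum_(S in unmarked_regions black p col) F S =
  \sum_(S in [set region_of x | x : dart D & black x == col]) F S.
Proof.
move=> F0; rewrite [RHS](big_setD1 (marked_region black p col)) /=; last first.
  rewrite /marked_region; case: ifP => hp; apply: imset_f; rewrite inE //.
  by rewrite (black_unrot hblack); move: hp; case: black; case: (col).
by rewrite F0 add0r.
Qed.

Lemma black_fst_corner col c : black (fst_corner black col c) = col.
Proof.
rewrite /fst_corner; case: ifP => [/eqP //|].
by have [-> _ _] := black_corners hblack c; case: black; case: col.
Qed.

(** The Goeritz matrix is a weighted graph Laplacian: each edge contributes its weight times the
    difference of [F] along it, at its two ends. The marked region drops out because [F] is 0
    there. *)
Lemma goeritz_row col n (r : 'I_n -> {set dart D}) (F : {set dart D} -> rat) R :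
    enumerates r (unmarked_regions black p col) ->
    F (marked_region black p col) = 0 ->
  \sum_j goeritz_entry black col R (r j) * F (r j) =
  \sum_c mu black c * (F (edge_tgt black col c) - F (edge_src black col c)) *
    ((edge_src black col c == R)%:R - (edge_tgt black col c == R)%:R).
Proof.
move=> hr F0.
rewrite (sum_enumerates (fun S => goeritz_entry black col R S * F S) hr).
rewrite sum_unmarked_regions ?F0 ?mulr0 //.
set A := [set _ | _ in _].
have sumA x : black x == col ->
    \sum_(S in A) (region_of x == S)%:R * F S = F (region_of x).
  move=> bx; rewrite (bigD1 (region_of x)) /=; last by apply: imset_f; rewrite inE.
  rewrite eqxx mul1r big1 ?addr0 // => S /andP[_ /negPf ne].
  by rewrite eq_sym ne mul0r.
have src_col c : black (fst_corner black col c) == col by rewrite black_fst_corner.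
have tgt_col c : black (opposite (fst_corner black col c)) == col.
  by rewrite (black_opposite hblack) black_fst_corner.
under eq_bigr => S _ do rewrite goeritz_entryE mulr_suml.
rewrite exchange_big; apply: eq_bigr => c _ /=; rewrite /edge_src /edge_tgt.
move: (src_col c) (tgt_col c) => /sumA sumS /sumA sumT.
set s := region_of (fst_corner _ _ _) in sumS *.
set t := region_of (opposite _) in sumT *.
have splitS S : ((s == R)%:R * (t == S)%:R + (s == S)%:R * (t == R)%:R -
     (R == S)%:R * ((s == R)%:R + (t == R)%:R)) =
  (s == R)%:R * ((t == S)%:R - (s == S)%:R) +
  (t == R)%:R * ((s == S)%:R - (t == S)%:R) :> rat.
  have [->|_] := eqVneq s R; have [->|_] := eqVneq t R; rewrite /=; ring.
rewrite -[F t]sumT -[F s]sumS -sumrB mulr_sumr mulr_suml.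
apply: eq_bigr => S _; rewrite splitS; ring.
Qed.

(* The difference across each crossing of a vector in the kernel is orthogonal to
   the columns of the Dehn system: by hypothesis for the regions of colour [col],
   by telescoping around the region for the others. *)
Lemma goeritz_matrix_unit col n (r : 'I_n -> {set dart D}) :
  enumerates r (unmarked_regions black p col) ->
  goeritz_matrix black col r \in unitmx.
Proof.
move=> hr; apply: unitmx_of_inj => v Gv0; have [injr imr] := hr.
pose F R := \sum_j v j 0 * (r j == R)%:R.
have FE j : F (r j) = v j 0.
  rewrite /F (bigD1 j) //= eqxx mulr1 big1 ?addr0 // => i /negPf ne.
  by rewrite (inj_eq injr) ne mulr0.
have F0 R : R \notin unmarked_regions black p col -> F R = 0.
  move=> nR; rewrite /F big1 // => j _; case: eqP => [E|_]; last by rewrite mulr0.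
  by case/negP: nR; rewrite -E -imr imset_f.
have Fm : F (marked_region black p col) = 0 by apply: F0; rewrite !inE eqxx.
have Fcol x : black x != col -> F (region_of x) = 0.
  move=> bx; apply: F0; rewrite inE negb_and orbC; apply/orP; left.
  apply/imsetP => -[y]; rewrite inE => /eqP by_ /(eq_region_black hblack) E.
  by rewrite E by_ eqxx in bx.
pose V x := F (region_of x).
(* The sign is such that, for a region of the other colour, [u] times the Dehn entries is the sum of
   [V (rot y) - V (unrot y)] over its corners [y]. *)
pose u c := if black (c, 1) == col then V (c, 1) - V (c, 3) else V (c, 2) - V (c, 0).
have u0 : forall c, u c = 0.
  apply: dehn_left_kernel => R; rewrite /all_unmarked => /setD1P[neR' /setD1P[neR]].
  case/imsetP=> x _ DR; case: (eqVneq (black x) col) => bx.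
    have RU : R \in unmarked_regions black p col.
      rewrite inE DR imset_f ?inE ?bx // andbT -DR /marked_region.
      by case: ifP; rewrite ?neR ?neR'.
    rewrite -imr in RU; case/imsetP: RU => i _ Dri.
    have := goeritz_row R hr Fm.
    rewrite (_ : \sum_j _ = 0); last first.
      move/colP/(_ i): Gv0; rewrite !mxE => Gi; rewrite -[RHS]Gi.
      by apply: eq_bigr => j _; rewrite !mxE FE -Dri.
    (* For a region of colour [col], the Dehn column and the Goeritz row agree up to this global
       sign. *)
    move/esym => E; rewrite -[RHS](mulr0 (if col then 1 else -1)) -[in RHS]E mulr_sumr.
    apply: eq_bigr => c _; rewrite /dehn_entry /u (mu_black hblack) /edge_src /edge_tgt.
    have memR y : (region_of y == R) = (y \in R).
      by rewrite eq_sym DR region_of_eq.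
    have memF y : black y != col -> (y \in R) = false.
      move=> by_; apply/negP; rewrite DR => /(black_region hblack) E'.
      by rewrite E' bx eqxx in by_.
    rewrite !memR /fst_corner; have [b1 b2 b3] := black_corners hblack c.
    rewrite b1; case: (eqVneq (black (c, 0)) col) => b0.
      rewrite !(memF (c, 1), memF (c, 3)) ?b1 ?b3 ?b0 //; try by case: (col).
      by rewrite opposite_corners /V; case: (col); rewrite /=; ring.
    rewrite !(memF (c, 0), memF (c, 2)) ?b2 //.
    rewrite opposite_corners /V; move: b0.
    by case: (black _); case: (col) => //= _; ring.
  have bR c i : (c, i) \in R -> black (c, i) = ~~ col.
    rewrite DR => /(black_region hblack) ->.
    by move: bx; case: black; case: (col).
  rewrite -[RHS](subrr (\sum_(y in R) V (rot y))).
  have {2}-> : \sum_(y in R) V (rot y) = \sum_(y in R) V (unrot y).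
    rewrite DR -[RHS]sum_region_face_next; apply: eq_bigr => y _.
    by rewrite /V /face_next region_unrot_mate.
  rewrite -sumrB sum_dart_in; apply: eq_bigr => c _.
  rewrite !rot_corners !unrot_corners /dehn_entry /u.
  have [b1 b2 b3] := black_corners hblack c.
  move: (bR c 0) (bR c 1) (bR c 2) (bR c 3); rewrite b1 b2 b3.
  case: (black (c, 0)); case: (col);
  case: (_ \in R) => [/(_ isT)// _|_]; case: (_ \in R) => [/(_ isT)// _|_];
  case: (_ \in R) => [/(_ isT)// _|_]; case: (_ \in R) => [/(_ isT)// _|_];
  by rewrite /= ?mulr1n ?mulr0n; ring.
have Vopp x : black x == col -> V (opposite x) = V x.
  case: x => c i; have := u0 c; rewrite /u; have [b1 b2 b3] := black_corners hblack c.
  rewrite b1; move: i; apply: Z4P; rewrite opposite_corners ?b1 ?b2 ?b3;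
  by case: (black _); case: (col) => //= /eqP; rewrite subr_eq0 => /eqP.
have Vunrot x : black x != col -> V (rot x) = V (unrot x).
  move=> bx; rewrite -rot_opposite oppositeE -[rot (rot (rot x))]oppositeE Vopp //.
  by rewrite (black_rot hblack); move: bx; case: black; case: (col).
(* The value of [V] on the side of colour [col] of the end [rot x]. It vanishes at [p] because of
   the marked region, and it is propagated along edges and around crossings. *)
pose f x := if black x == col then V x else V (rot x).
have f0 x : f x = 0.
  apply: (dart_connected (P := fun x => f x = 0) (x := p)) => [|y|y]; rewrite /f.
  - rewrite /V; case: ifP => bp; first by rewrite -Fm /marked_region bp.
    by rewrite -/(V _) Vunrot ?bp // -Fm /marked_region bp.
  - rewrite (black_mate hblack); case: ifP => by_; case: ifP => bm.
    + by move: by_ bm; case: black; case: (col).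
    + rewrite Vunrot ?(black_mate hblack) ?bm //.
      by rewrite /V region_unrot_mate.
    + by rewrite /V region_mate => <-; apply/esym/Vunrot; rewrite by_.
    + by move: by_ bm; case: black; case: (col).
  rewrite (black_rot hblack); case: ifP => by_; case: ifP => // bm.
  + by move: by_ bm; case: black; case: (col).
  + by rewrite -oppositeE Vopp ?by_.
  by move: by_ bm; case: black; case: (col).
apply/colP => j; rewrite mxE -FE.
have : r j \in unmarked_regions black p col by rewrite -imr imset_f.
case/setD1P=> _ /imsetP[y]; rewrite inE => by_ ->.
by have := f0 y; rewrite /f by_.
Qed.

End Goeritz.

(** * Arcs as orbits *)

Section ArcOrbits.
Variable D : diagram.
Implicit Types (x y u : dart D).

(** Crosses over at an over-end and turns back at an under-end, so that [arc_next] walks around the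
    boundary of the neighbourhood of an arc, down one side and back along the other. *)
Definition through x : dart D := if odd x.2 then opposite x else x.
Definition arc_next x : dart D := through (mate x).

Lemma through_corners (c : crossing D) :
  ((through (c, 0) = (c, 0)) * (through (c, 1) = (c, 3)) *
   (through (c, 2) = (c, 2)) * (through (c, 3) = (c, 1)))%type.
Proof. by rewrite /through /= !opposite_corners. Qed.

Lemma throughK : involutive through.
Proof. by apply: dart_ind => c; rewrite !through_corners. Qed.

Lemma arc_next_inj : injective arc_next.
Proof. exact: (inj_comp (inv_inj throughK) (inv_inj (@mateK D))). Qed.

Lemma arc_through x : arc_of (through x) = arc_of x.
Proof. by rewrite /through; case: ifP => // /arc_opposite. Qed.

Lemma arc_of_next x : arc_of (arc_next x) = arc_of x.
Proof. by rewrite arc_through arc_mate. Qed.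

(** [arc_next] is the product of the involutions [through] and [mate], hence [through] conjugates it
    to its inverse: it acts on the orbit of an under-end as a reflection. *)
Lemma iter_arc_next_through u k : through u = u ->
  iter k arc_next (through (iter k arc_next u)) = u.
Proof.
move=> fix_u; elim: k => [//|k IH].
by rewrite iterSr /= /arc_next throughK mateK -/(arc_next _) IH.
Qed.

(** By reflection the orbit of [u] is stable under [through], hence under [mate], and these two
    generate the arc. *)
Lemma arc_orbit_under_end u y : through u = u -> y \in arc_of u ->
  fconnect arc_next u y.
Proof.
move=> fix_u; rewrite inE; have sym := fconnect_sym arc_next_inj.
have thr z : fconnect arc_next u z -> fconnect arc_next u (through z).
  move=> uz; have := iter_arc_next_through (findex arc_next u z) fix_u.
  rewrite sym => <-.
  by rewrite iter_findex // fconnect_iter.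
apply: (@connect_ind_r _ _ (fun z => fconnect arc_next u z)) => // z t uz.
case/orP=> [/eqP -> | /andP[oz /eqP ->]].
  rewrite -[mate z]throughK; apply/thr/(connect_trans uz).
  exact: (fconnect1 arc_next).
by have := thr z uz; rewrite /through oz.
Qed.

(** A reflection of a cycle of length [n] fixing [u] has at most one other fixed point, halfway
    around: a fixed point of index [i] satisfies [i + i = 0] or [i + i = n]. *)
Lemma card_under_ends_arc u : through u = u ->
  (#|[set y in arc_of u | ~~ odd y.2]| <= 2)%N.
Proof.
move=> fix_u; pose n := fingraph.order arc_next u.
apply: leq_trans (_ : #|[set u; iter n./2 arc_next u]| <= 2)%N; last first.
  by rewrite cards2; case: eqP.
apply/subset_leq_card/subsetP => y; rewrite !inE => /andP[uy ey].
have {}uy : fconnect arc_next u y by apply: arc_orbit_under_end; rewrite ?inE.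
have fix_y : through y = y by rewrite /through (negPf ey).
have ltin : (findex arc_next u y < n)%N by apply: findex_max.
rewrite -(iter_findex uy); set i := findex _ _ _ in ltin *.
have per : iter (i + i) arc_next u = u.
  rewrite iterD; have := iter_arc_next_through i fix_u.
  by rewrite [iter i _ u]iter_findex // fix_y.
have iter0 k : (k < n)%N -> iter k arc_next u = u -> k = 0%N.
  by move=> kn E; have := findex_iter kn; rewrite E findex0.
case: (ltnP (i + i) n) => [lt|ge].
  by have := iter0 _ lt per; case: (i) => //= _; rewrite eqxx.
have : iter (i + i - n) arc_next u = u.
  have := per; rewrite -{1}(subnK ge) iterD iter_order //; exact: arc_next_inj.
move/iter0 => z; have -> : n./2 = i by have := z ltac:(lia); lia.
by rewrite eqxx orbT.
Qed.

Hypothesis card_arcs : #|arcs D| = #|crossing D|.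

(* The 2 #|crossing D| under-ends are shared by as many arcs as crossings, at most
   two on each arc, so that no arc is a closed curve without undercrossings. *)
Lemma arc_has_under_end x : exists2 u, through u = u & x \in arc_of u.
Proof.
pose under (a : {set dart D}) := #|[set y in a | ~~ odd y.2]|.
have sum_under : (\sum_(a in arcs D) under a = 2 * #|crossing D|)%N.
  transitivity #|[set y : dart D | ~~ odd y.2]|; last first.
    rewrite -sum1_card big_mkcond sum_dart -sum1_card big_distrr /=.
    by apply: eq_bigr => c _; rewrite !inE.
  rewrite -sum1_card (partition_big (@arc_of D) (mem (arcs D))) /=; last first.
    by move=> y _; apply: mem_arcs.
  apply: eq_bigr => a aD; rewrite /under -sum1_card; apply: eq_bigl => y.
  by rewrite !inE andbC mem_arc_arcs // eq_sym.
have fixE y : ~~ odd y.2 -> through y = y by rewrite /through => /negPf ->.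
have le2 a : a \in arcs D -> (under a <= 2)%N.
  move=> aD; rewrite /under; case: (set_0Vmem [set y in a | ~~ odd y.2]) => [->|[y]].
    by rewrite cards0.
  rewrite inE => /andP[ya /fixE fix_y].
  by rewrite (arc_of_arcs aD ya) card_under_ends_arc.
have [u0|[u]] := set_0Vmem [set y in arc_of x | ~~ odd y.2]; last first.
  rewrite inE => /andP[ux /fixE fix_u]; exists u => //.
  by rewrite (arc_of_mem ux) mem_arc.
have : (\sum_(a in arcs D) under a <= \sum_(a in arcs D :\ arc_of x) 2)%N.
  rewrite (big_setD1 _ (mem_arcs x)) /= {1}/under u0 cards0 add0n.
  by apply: leq_sum => a /setD1P[_ /le2].
have := cardsD1 (arc_of x) (arcs D); rewrite mem_arcs card_arcs.
by rewrite sum_under sum_nat_const => ->; rewrite mulnC leq_pmul2r // ltnn.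
Qed.

Lemma arc_orbit x y : y \in arc_of x -> fconnect arc_next x y.
Proof.
move=> yx; have [u fix_u xu] := arc_has_under_end x.
have yu : y \in arc_of u by rewrite -(arc_of_mem xu).
apply: (connect_trans (y := u)); last exact: arc_orbit_under_end.
by rewrite (fconnect_sym arc_next_inj) arc_orbit_under_end.
Qed.

End ArcOrbits.

(** * Regions of the Heegaard diagram *)

Section Regions.
Variables (D : diagram) (black : dart D -> bool) (p : dart D).
Hypothesis hblack : checkerboard black.
Implicit Types (x y : dart D) (s : point D).

(** With each circle segment indexed by the end it runs along, the walk on the top is [arc_next] and
    the one on the bottom is [unrot (mate x)], the inverse of [face_next], away from the marked
    edge. *)
Lemma top_arcE x : top_arc (inl x) = inl (unrot (through x)).
Proof.
congr inl; move: x; apply: dart_ind => c; rewrite !through_corners !unrot_corners.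
by split; congr (_, _); apply/eqP.
Qed.

Lemma bottom_arcE x : bottom_arc (inl x) = inl (unrot (unrot x)) :> point D.
Proof. by rewrite /= -[unrot x]rot_opposite dart_rotK. Qed.

Lemma top_arcK : involutive (@top_arc D).
Proof. by case=> [[c i]|b] /=; rewrite ?negbK // subKr. Qed.

Lemma bottom_arcK : involutive (@bottom_arc D).
Proof. by case=> [x|b] /=; rewrite ?negbK ?oppositeK. Qed.

Lemma alpha_next_inl x : x != p -> x != mate p ->
  alpha_next black p (inl (unrot x)) = inl (mate x).
Proof. by move=> /negPf xp /negPf xp'; rewrite /= /face_next dart_unrotK xp xp'. Qed.

Lemma alpha_next_marked x : x = p \/ x = mate p ->
  alpha_next black p (inl (unrot x)) = inr (~~ black x) /\
  alpha_next black p (inr (black x)) = inl x.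
Proof.
rewrite /= dart_unrotK (black_unrot hblack).
by case=> ->; rewrite eqxx ?orbT ?(black_mate hblack) //; case: (black p).
Qed.

Lemma alpha_next_inj : injective (alpha_next black p).
Proof.
pose prev s := match s with
  | inl x => if (x == p) || (x == mate p) then inr (black x) else inl (unrot (mate x))
  | inr b => inl (unrot (if black p == b then mate p else p)) end.
apply: (can_inj (g := prev)) => -[y|b] /=.
  case: ifP => [/orP[] /eqP E|/norP[yp yp']] /=.
  - by rewrite -[y]dart_rotK E (black_unrot hblack); case: (black p).
  - by rewrite -[y]dart_rotK E (black_unrot hblack) (black_mate hblack); case: (black p).
  rewrite /face_next (inv_eq (@mateK D)) (negPf yp') (inj_eq (inv_inj (@mateK D))).
  by rewrite (negPf yp) /= mateK dart_rotK.
case: (boolP (black p == b)) => [/eqP <-|ne];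
  rewrite eqxx ?orbT /= ?(black_mate hblack) //.
by move: ne; case: (black p); case: b.
Qed.

Definition side_next (u : side D) : side D :=
  ((if u.2 then @top_arc D else @bottom_arc D) (alpha_next black p u.1), u.2).

Lemma side_next_inj : injective side_next.
Proof.
move=> [s b] [s' b'] /= [] E Eb; move: E; rewrite -{}Eb /=.
have arcK : involutive (if b then @top_arc D else @bottom_arc D).
  by case: b; [apply: top_arcK | apply: bottom_arcK].
by move/(inv_inj arcK)/alpha_next_inj ->.
Qed.

(** The relation is not symmetric, but [side_next] is a permutation, so a step is undone by going on
    around its orbit. *)
Lemma hregion_step u v : same_region_step black p u v ->
  hregion black p u = hregion black p v.
Proof.
have sym : connect_sym (same_region_step black p).
  have next_sub : subrel (connect (frel side_next)) (connect (same_region_step black p)).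
    apply: connect_sub => s t /eqP <-; apply: connect1.
    by rewrite /same_region_step /= /side_next eqxx.
  apply: connect_pre_sym => {u v}u v /orP[/eqP ->|].
    by apply: next_sub; rewrite (fconnect_sym side_next_inj) fconnect1.
  case/andP=> du /eqP ->; apply: connect1.
  by rewrite /same_region_step /= du negbK -surjective_pairing eqxx orbT.
by move=> uv; apply/setP => w; rewrite !inE; apply: same_connect (connect1 uv) _.
Qed.

Lemma hregion_next s t : hregion black p (s, t) =
  hregion black p ((if t then @top_arc D else @bottom_arc D) (alpha_next black p s), t).
Proof. by apply: hregion_step; rewrite /same_region_step /= eqxx. Qed.

Lemma hregion_delta1 s : on_delta1 black p s ->
  hregion black p (s, true) = hregion black p (s, false).
Proof. by move=> ds; apply: hregion_step; rewrite /same_region_step /= ds eqxx orbT. Qed.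

Definition top_region x := hregion black p (inl (unrot x), true).
Definition bottom_region x := hregion black p (inl (unrot x), false).

Lemma top_region_next x : x != p -> x != mate p ->
  top_region (arc_next x) = top_region x.
Proof.
by move=> xp xp'; rewrite [RHS]/top_region hregion_next alpha_next_inl // top_arcE.
Qed.

Lemma bottom_region_next x : x != p -> x != mate p ->
  bottom_region (unrot (mate x)) = bottom_region x.
Proof.
by move=> xp xp'; rewrite [RHS]/bottom_region hregion_next alpha_next_inl // bottom_arcE.
Qed.

(** On reaching the marked point, the walk follows [beta_p] to the other circle and comes back to
    the crossing that it left. *)
Lemma top_region_marked x : x = p \/ x = mate p ->
  hregion black p (inr (black x), true) = top_region x /\
  top_region (through x) = top_region x.
Proof.
move=> /alpha_next_marked[E E'].
have Ex : top_region x = hregion black p (inr (black x), true).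
  by rewrite /top_region hregion_next E /= negbK.
by split=> //; rewrite Ex hregion_next E' top_arcE.
Qed.

(** Here the detour along [beta_p] leads from one marked face to the other. *)
Lemma bottom_region_marked x : x = p \/ x = mate p ->
  hregion black p (inr (black x), false) = bottom_region x /\
  bottom_region (unrot x) = bottom_region x.
Proof.
move=> /alpha_next_marked[E E'].
have Ex : bottom_region x = hregion black p (inr (black x), false).
  by rewrite /bottom_region hregion_next E /= negbK.
by split=> //; rewrite Ex hregion_next E' bottom_arcE.
Qed.

Lemma arc_region_top x : #|arcs D| = #|crossing D| -> p \notin arc_of x ->
  arc_region black p (arc_of x) = top_region x.
Proof.
move=> card_arcs px; apply/eqP; rewrite eqEsubset; apply/andP; split; last first.
  by apply: (bigcup_max x); rewrite ?mem_arc.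
apply/bigcupsP => y /(arc_orbit card_arcs) xy; rewrite -/(top_region y).
suff [_ ->] : y \in arc_of x /\ top_region y = top_region x by [].
apply: (connect_ind_r (P := fun z => z \in _ /\ top_region z = _)) xy => //.
  by rewrite mem_arc.
move=> u v [ux <-] /eqP <-; split; first by rewrite -arc_of_eq arc_of_next arc_of_eq.
apply: top_region_next; apply: contraNneq px => E; first by rewrite -E.
by rewrite -arc_of_eq -(arc_mate p) -E arc_of_eq.
Qed.

Lemma face_region_bottom x : p \notin region_of x -> mate p \notin region_of x ->
  face_region black p (region_of x) = bottom_region x.
Proof.
move=> px px'; apply/eqP; rewrite eqEsubset; apply/andP; split; last first.
  by apply: (bigcup_max x); rewrite ?mem_region.
apply/bigcupsP => y xy; rewrite -/(bottom_region y).
suff [_ ->] : y \in region_of x /\ bottom_region y = bottom_region x by [].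
rewrite inE in xy.
apply: (connect_ind_r (P := fun z => z \in _ /\ bottom_region z = _)) xy => //.
  by rewrite mem_region.
move=> u v [ux <-] /eqP <-; set v' := face_next _ _.
have v'x : v' \in region_of x by rewrite -region_of_eq region_face_next region_of_eq.
split=> //; rewrite -bottom_region_next /v' /face_next ?mateK ?dart_rotK //.
  by apply: contraNneq px => <-.
by apply: contraNneq px' => <-.
Qed.

End Regions.

(** * The domain *)

Section BetaCurves.
Variable D : diagram.
Implicit Types (s : point D) (c : crossing D).

Lemma beta_next_inj : injective (@beta_next D).
Proof.
pose prev s := if starts_on_top s then bottom_arc s else top_arc s.
apply: (can_inj (g := prev)) => s; rewrite /beta_next /prev.
have top_start t : starts_on_top (top_arc t) = ~~ starts_on_top (t : point D).
  by case: t => [[c]|//]; apply: Z4P.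
have bottom_start t : starts_on_top (bottom_arc t) = ~~ starts_on_top (t : point D).
  by case: t => [[c]|//]; apply: Z4P.
case: (boolP (starts_on_top s)) => hs; first by rewrite top_start hs top_arcK.
by rewrite bottom_start hs bottom_arcK.
Qed.

Lemma beta_next_corners c :
  ((beta_next (inl (c, 0)) = inl (c, 3)) * (beta_next (inl (c, 3)) = inl (c, 1)) *
   (beta_next (inl (c, 1)) = inl (c, 2)) * (beta_next (inl (c, 2)) = inl (c, 0)))%type.
Proof.
rewrite /beta_next /= !opposite_corners.
by do !split; congr (inl (_, _)); apply/eqP.
Qed.

Lemma beta_fconnect c i j :
  fconnect (@beta_next D) (inl (c, i)) (inl (c, j)).
Proof.
pose s : seq (point D) := [:: inl (c, 0); inl (c, 3); inl (c, 1); inl (c, 2)].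
have cyc : fcycle (@beta_next D) s by rewrite /= !beta_next_corners !eqxx.
have mem_s k : inl (c, k) \in s.
  by rewrite !inE; move: k; apply: Z4P; rewrite ?eqxx ?orbT.
by rewrite (fconnect_cycle cyc).
Qed.

(** The rational multiple of the whole curve disappears from differences. *)
Lemma joins_step (next : point D -> point D) u v d s : injective next ->
  joins next u v d -> fconnect next u v -> fconnect next u s ->
  d (next s) - d s = (next s == u)%:R - (next s == v)%:R.
Proof.
move=> inj_next [r dE] uv us.
rewrite !dE ?(connect_trans us (fconnect1 _ _)) // -traject_step //; ring.
Qed.

End BetaCurves.

(** * Local equations satisfied by the coefficients of the domain *)

Section Domain.
Variables (D : diagram) (black : dart D -> bool) (p : dart D).
Hypothesis hblack : checkerboard black.
Hypothesis card_arcs : #|arcs D| = #|crossing D|.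
Variables (x y : crossing D -> 'Z_4) (outward : bool) (q : {set side D} -> rat).
Hypothesis hx : kauffman_state black p x.
Hypothesis hy : kauffman_state black p y.
Hypothesis hq : is_domain black p outward x y q.

Local Notation sigma := (orientation_sign outward).
Local Notation T z := (q (top_region black p z)).
Local Notation B z := (q (bottom_region black p z)).

Lemma sigmaK r : sigma * (sigma * r) = r.
Proof. by rewrite /orientation_sign; case: outward; ring. Qed.

(** [next] permutes the ends of the colour of [p] and preserves [B] at all of them except perhaps
    [p]. Comparing the sums of [B z] and [B (next z)] settles the case of [p], where the detour
    identifies [B (next p)] with [B (mate p)]. *)
Lemma bottom_marked_eq : B (mate p) = B p.
Proof.
have [_ bmp] := bottom_region_marked hblack (or_intror (erefl (mate p))).
pose next (z : dart D) := unrot (mate z).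
have inj_next : injective next.
  exact: (inj_comp (can_inj (@dart_unrotK D)) (inv_inj (@mateK D))).
have black_next z : black (next z) = black z.
  by rewrite /next (black_unrot hblack) (black_mate hblack) negbK.
have: \sum_(z | black z == black p) B z = \sum_(z | black z == black p) B (next z).
  rewrite [LHS](reindex_inj inj_next); apply: eq_bigl => z.
  by rewrite black_next.
rewrite (bigD1 p) ?eqxx //= [RHS](bigD1 p) ?eqxx //= bmp => /esym.
rewrite (eq_bigr (fun z => B z)) => [|z /andP[bz zp]]; first exact: addIr.
rewrite bottom_region_next //; apply: contraTneq bz => ->.
by rewrite (black_mate hblack); case: (black p).
Qed.

(** The boundary has a constant coefficient along [beta_p], which is 0 since the two sides of the
    bottom arc agree. So the zero at the basepoint passes across the top arc, and then to the bottom
    through [delta_1]. *)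
Lemma domain_marked b t : q (hregion black p (inr b, t)) = 0.
Proof.
have [q0 [da [db [_ _ [jb _] _ dbE]]]] := hq.
have bot : q (hregion black p (inr true, false)) = q (hregion black p (inr false, false)).
  have [Ep _] := bottom_region_marked hblack (or_introl (erefl p)).
  have [Em _] := bottom_region_marked hblack (or_intror (erefl (mate p))).
  move: bottom_marked_eq; rewrite -Ep -Em (black_mate hblack).
  by case: (black p).
have dlt : hregion black p (inr false, true) = hregion black p (inr false, false).
  exact: hregion_delta1.
have := joins_step (@beta_next_inj D) jb (connect0 _ _) (connect0 _ _).
rewrite subrr -!dbE /beta_left /beta_right /beta_next /= bot subrr mulr0 q0 subr0 sub0r.
move/eqP; rewrite oppr_eq0 => /eqP E.
have q1 : q (hregion black p (inr false, true)) = 0 by rewrite -[LHS]sigmaK E mulr0.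
by case: b; case: t; rewrite ?q0 ?q1 // ?bot -dlt q1.
Qed.

Lemma domain_marked_top z : z = p \/ z = mate p -> T z = 0.
Proof. by move=> /(top_region_marked hblack)[<- _]; apply: domain_marked. Qed.

Lemma domain_marked_bottom z : z = p \/ z = mate p -> B z = 0.
Proof. by move=> /(bottom_region_marked hblack)[<- _]; apply: domain_marked. Qed.

(** The walk only leaves [arc_next] at the marked edge, and there both values are 0. *)
Lemma domain_top_arc z z' : arc_of z = arc_of z' -> T z = T z'.
Proof.
move=> /eqP; rewrite arc_of_eq => /(arc_orbit card_arcs).
apply: (connect_ind_r (P := fun w => T z = T w)) => // u v -> /eqP <-.
have thr w : w = p \/ w = mate p -> T (through w) = 0.
  by move=> hw; have [_ ->] := top_region_marked hblack hw; apply: domain_marked_top.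
have [->|up] := eqVneq u p; first by rewrite thr ?domain_marked_top; auto.
have [->|up'] := eqVneq u (mate p); last by rewrite top_region_next.
by rewrite domain_marked_top; auto; rewrite /arc_next mateK thr; auto.
Qed.

Lemma domain_bottom_region z z' : region_of z = region_of z' -> B z = B z'.
Proof.
move=> /esym/eqP; rewrite region_of_eq inE.
apply: (connect_ind_r (P := fun w => B w = B z')) => // u v <- /eqP <-.
rewrite /face_next -{2}[u]dart_rotK -[in RHS](mateK (rot u)).
move: (mate (rot u)) => w.
have unr t : t = p \/ t = mate p -> B (unrot t) = 0.
  by move=> ht; have [_ ->] := bottom_region_marked hblack ht; apply: domain_marked_bottom.
have [->|wp] := eqVneq w p; first by rewrite unr ?domain_marked_bottom; auto.
have [->|wp'] := eqVneq w (mate p); last by rewrite bottom_region_next.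
by rewrite domain_marked_bottom; auto; rewrite mateK unr; auto.
Qed.

(** The marked arc is given the value 0 outright because [arc_region_top] concerns arcs that avoid
    [p]. *)
Definition arc_value a := if a == arc_of p then 0 else q (arc_region black p a).

Lemma arc_valueE z : arc_value (arc_of z) = T z.
Proof.
rewrite /arc_value arc_of_eq; case: ifP => [pz|/negbT npz].
  by rewrite (@domain_top_arc z p) ?domain_marked_top ?(arc_of_mem pz); auto.
by rewrite arc_region_top.
Qed.

Definition face_value v :=
  if (v == region_of p) || (v == region_of (mate p)) then 0
  else q (face_region black p v).

Lemma face_valueE z : face_value (region_of z) = B z.
Proof.
rewrite /face_value; case: ifP => [/orP[]/eqP /domain_bottom_region ->|/norP[]].
- by rewrite domain_marked_bottom; auto.
- by rewrite domain_marked_bottom; auto.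
by rewrite !region_of_eq => zp zp'; rewrite face_region_bottom.
Qed.

(* The boundary of the domain crosses beta_c at the corners 0, 3, 1, 2 in turn,
   and its multiplicity only jumps at the corners chosen by [y] and [x]. *)
Lemma domain_at_crossing c : exists r,
  let jump i : rat := (i == y c)%:R - (i == x c)%:R in
  [/\ T (c, 3) = T (c, 1), T (c, 0) = T (c, 1) + sigma * r,
      T (c, 2) = T (c, 1) - sigma * (r + jump 3 + jump 1),
      B (c, 0) = B (c, 2) + sigma * (r + jump 3) &
      B (c, 3) = B (c, 1) + sigma * (r + jump 3 + jump 1 + jump 2)].
Proof.
have [_ [da [db [_ _ [_ jc] _ dbE]]]] := hq.
have step i := joins_step (@beta_next_inj D) (jc c)
  (beta_fconnect c _ _) (beta_fconnect c (y c) i).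
(* The coefficient of the arc of [beta_c] from the corner 0 to the corner 3, where the traversal
   starts. *)
exists (db (inl (c, 0))) => jump.
have := step 0; have := step 3; have := step 1.
rewrite !beta_next_corners.
have eqE i j : (inl (c, i) == inl (c, j) :> point D) = (i == j).
  by rewrite (inj_eq (@inl_inj _ _)) xpair_eqE eqxx.
rewrite !eqE -/(jump 3) -/(jump 1) -/(jump 2) => s1 s3 s0.
have e0 := dbE (inl (c, 0)); have e1 := dbE (inl (c, 1)).
have e2 := dbE (inl (c, 2)); have e3 := dbE (inl (c, 3)).
have T31 : T (c, 3) = T (c, 1) by apply: domain_top_arc; apply: arc_overstrand.
move: e0 e1 e2 e3; rewrite /beta_left /beta_right /= !beta_next_corners.
have tE : ((hregion black p (inl (c, 3), true) = top_region black p (c, 0)) *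
   (hregion black p (inl (c, 0), true) = top_region black p (c, 1)) *
   (hregion black p (inl (c, 1), true) = top_region black p (c, 2)) *
   (hregion black p (inl (c, 2), true) = top_region black p (c, 3)) *
   (hregion black p (inl (c, 3), false) = bottom_region black p (c, 0)) *
   (hregion black p (inl (c, 0), false) = bottom_region black p (c, 1)) *
   (hregion black p (inl (c, 1), false) = bottom_region black p (c, 2)) *
   (hregion black p (inl (c, 2), false) = bottom_region black p (c, 3)))%type.
  by rewrite /top_region /bottom_region !unrot_corners.
rewrite !tE => e0 e1 e2 e3.
have sK u v w : sigma * (u - v) = w -> u = v + sigma * w.
  by move=> <-; rewrite sigmaK addrC subrK.
move: e0 e1 e2 e3 => /sK e0 /sK e1 /sK e2 /sK e3.
have d3 : db (inl (c, 3)) = db (inl (c, 0)) + jump 3 by lra.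
have d1 : db (inl (c, 1)) = db (inl (c, 0)) + jump 3 + jump 1 by lra.
have d2 : db (inl (c, 2)) = db (inl (c, 0)) + jump 3 + jump 1 + jump 2 by lra.
split=> //; rewrite -?d2 -?d1 -?d3 //.
by rewrite -T31 e1; ring.
Qed.

(** The unknown [r] cancels and the jumps at the corners 1 and 3 remain. These corners share a
    colour, so the jumps add up to a difference of colour indicators, whose sign is fixed by
    [mu]. *)
Lemma domain_coloring_row c :
  mu black c * (T (c, 0) + T (c, 2) - 2 * T (c, 1)) =
  - sigma * (xi black x c - xi black y c).
Proof.
have [r /= [_ -> -> _ _]] := domain_at_crossing c.
rewrite (mu_black hblack) /xi; have [b1 b2 b3] := black_corners hblack c.
by move: (x c) (y c); apply: Z4P; apply: Z4P; rewrite ?b1 ?b2 ?b3;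
  case: (black _) => /=; ring.
Qed.

Lemma sum_state_corners z : \sum_c ((c, x c) \in region_of z)%:R =
  \sum_c ((c, y c) \in region_of z)%:R :> rat.
Proof.
have E t : \sum_c ((c, t c) \in region_of z)%:R =
    #|[set c | (c, t c) \in region_of z]|%:R :> rat.
  rewrite -sum1_card natr_sum [RHS]big_mkcond; apply: eq_bigr => c _.
  by rewrite inE; case: (_ \in _).
by rewrite !E hx ?mem_regions // hy ?mem_regions.
Qed.

Lemma flip_corners c :
  (((c, 3 - 0) = (c, 3) :> dart D) * ((c, 3 - 1) = (c, 2) :> dart D) *
   ((c, 3 - 2) = (c, 1) :> dart D) * ((c, 3 - 3) = (c, 0) :> dart D))%type.
Proof. by do !split; congr (_, _); apply/eqP. Qed.

(** Compares the orientation given by a state with a fixed one: the sign is -1 when the head is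
    [fst_corner], the corners 3 and 0 being on the same side of the overstrand. *)
Lemma edge_orientation col c (t : crossing D -> 'Z_4) (R : {set dart D}) :
  (edge_tail black col t c \in R)%:R - (edge_head black col t c \in R)%:R =
  (if (black (c, 0) == col) == ((t c == 0) || (t c == 3)) then -1 else 1) *
  ((fst_corner black col c \in R)%:R -
   (opposite (fst_corner black col c) \in R)%:R) :> rat.
Proof.
rewrite /edge_tail /edge_head /fst_corner; have [b1 b2 b3] := black_corners hblack c.
move: (t c); apply: Z4P; rewrite ?flip_corners ?b1 ?b2 ?b3;
case: (black (c, 0)); case: (col); rewrite ?opposite_corners /=;
by rewrite ?opposite_corners ?mul1r ?mulN1r ?opprB.
Qed.

Definition coloring_sign (col : bool) : rat := if col then 1 else -1.

(* The last two terms vanish when summed over the crossings: the first one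
   telescopes around the region [region_of z], which moreover contains as many
   corners of [x] as of [y]. *)
Lemma domain_goeritz_term z c : let col := black z in let R := region_of z in
  mu black c * (B (opposite (fst_corner black col c)) - B (fst_corner black col c)) *
    ((fst_corner black col c \in R)%:R - (opposite (fst_corner black col c) \in R)%:R) =
  coloring_sign col * (sigma * (- (1 / 2) *
    (((edge_tail black col x c \in R)%:R - (edge_head black col x c \in R)%:R) -
     ((edge_tail black col y c \in R)%:R - (edge_head black col y c \in R)%:R))) +
  ((T (c, 1) - T (c, 0)) *+ ((c, 0) \in R) + (T (c, 2) - T (c, 1)) *+ ((c, 1) \in R) +
   (T (c, 3) - T (c, 2)) *+ ((c, 2) \in R) + (T (c, 0) - T (c, 3)) *+ ((c, 3) \in R)) +
  sigma * (((c, y c) \in R)%:R - ((c, x c) \in R)%:R)).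
Proof.
move=> col R.
have memF t : black t != col -> (t \in R) = false.
  by move=> bt; apply/negP => /(black_region hblack) E; rewrite E eqxx in bt.
have [r /= [T3 T0 T2 B0 B3]] := domain_at_crossing c.
have [b1 b2 b3] := black_corners hblack c.
(* Only the two corners of colour [col] at [c] can belong to [R]. *)
have cornersF : if black (c, 0) == col
    then ((c, 1) \in R) = false /\ ((c, 3) \in R) = false
    else ((c, 0) \in R) = false /\ ((c, 2) \in R) = false.
  case: ifP => b0; split; apply: memF; rewrite ?b1 ?b2 ?b3;
    by move: b0; case: (black _); case: (col).
rewrite !edge_orientation /fst_corner /coloring_sign (mu_black hblack).
have chosen t : ((c, t c) \in R)%:R = (t c == 0)%:R * ((c, 0) \in R)%:R +
   (t c == 1)%:R * ((c, 1) \in R)%:R + (t c == 2)%:R * ((c, 2) \in R)%:R +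
   (t c == 3)%:R * ((c, 3) \in R)%:R :> rat.
  by move: (t c); apply: Z4P; rewrite /= !mul0r ?mul1r ?addr0 ?add0r.
rewrite (chosen x) (chosen y) -!(mulr_natr (_ - _)) T0 T2 T3.
move: cornersF B0 B3 {chosen T0 T2 T3 memF}.
case: ifP => b0 -[-> ->]; rewrite !opposite_corners.
  have -> : (if black (c, 0) then 1 else -1) = (if col then 1 else -1) :> rat.
    by rewrite (eqP b0).
  move=> -> _; move: ((c, 0) \in R)%:R ((c, 2) \in R)%:R (T (c, 1)) (B (c, 2)) sigma.
  move: (if col then _ else _) => e.
  by move: (x c) (y c); apply: Z4P; apply: Z4P => I0 I2 T1 B2 s; rewrite /=; field.
have -> : (if black (c, 0) then 1 else -1) = - (if col then 1 else -1) :> rat.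
  by move: b0; case: (black _); case: (col) => // _; rewrite opprK.
move=> _ ->; move: ((c, 1) \in R)%:R ((c, 3) \in R)%:R (T (c, 1)) (B (c, 1)) sigma.
move: (if col then _ else _) => e.
by move: (x c) (y c); apply: Z4P; apply: Z4P => I0 I2 T1 B2 s; rewrite /=; field.
Qed.

Lemma domain_goeritz_row z : let col := black z in let R := region_of z in
  \sum_c mu black c *
    (B (opposite (fst_corner black col c)) - B (fst_corner black col c)) *
    ((fst_corner black col c \in R)%:R - (opposite (fst_corner black col c) \in R)%:R) =
  coloring_sign col * (sigma * (- (1 / 2) *
    (degree black col x R - degree black col y R))).
Proof.
move=> col R; under eq_bigr => c _ do rewrite domain_goeritz_term.
rewrite -mulr_sumr; congr (_ * _); rewrite 2!big_split /= -!mulr_sumr !sumrB.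
rewrite sum_state_corners subrr mulr0 addr0.
have -> : \sum_c ((T (c, 1) - T (c, 0)) *+ ((c, 0) \in R) +
   (T (c, 2) - T (c, 1)) *+ ((c, 1) \in R) +
   (T (c, 3) - T (c, 2)) *+ ((c, 2) \in R) +
   (T (c, 0) - T (c, 3)) *+ ((c, 3) \in R)) = \sum_(t in R) (T (rot t) - T t).
  by rewrite sum_dart_in; apply: eq_bigr => c _; rewrite !rot_corners.
(* [rot t] and the next corner of the region are the two ends of one edge, so they have the same arc
   coefficient. *)
have -> : \sum_(t in R) (T (rot t) - T t) = 0.
  rewrite sumrB -(sum_region_face_next z (fun t => T t)) -sumrB big1 // => t _.
  apply/eqP; rewrite subr_eq0; apply/eqP/domain_top_arc.
  by rewrite /face_next arc_mate.
by rewrite addr0 /degree !sumrB.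
Qed.

End Domain.

(** * Solution of the linear systems *)

Lemma goeritz_solution (D : diagram) (p : dart D) (black : dart D -> bool)
    (x y : crossing D -> 'Z_4) (outward : bool) (q : {set side D} -> rat)
    (col : bool) n (r : 'I_n -> {set dart D}) :
  checkerboard black -> link_det D != 0%N -> #|arcs D| = #|crossing D| ->
  kauffman_state black p x -> kauffman_state black p y ->
  is_domain black p outward x y q ->
  enumerates r (unmarked_regions black p col) ->
  \col_j q (face_region black p (r j)) =
    orientation_sign outward *: (- coloring_sign col / 2 *:
      (invmx (goeritz_matrix black col r) *m
         (\col_i degree black col x (r i) - \col_i degree black col y (r i)))).
Proof.
move=> hblack hdet card_arcs hx hy hq hr.
have unitG := goeritz_matrix_unit hblack hdet hr.
have rP i : exists2 z, black z = col & r i = region_of z /\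
    r i != marked_region black p col.
  have : r i \in unmarked_regions black p col by case: hr => _ <-; apply: imset_f.
  by case/setD1P=> ne /imsetP[z]; rewrite inE => /eqP bz E; exists z; rewrite // -E.
pose F : {set dart D} -> rat := face_value black p q.
have FE := face_valueE hblack hq.
have marked_value z : z = p \/ z = mate p -> F (region_of z) = 0.
  by case=> ->; rewrite /F /face_value eqxx ?orbT.
have Fm : F (marked_region black p col) = 0.
  rewrite /marked_region; case: ifP => _; last rewrite -region_mate;
  by apply: marked_value; auto.
(* An unmarked region of colour [col] is neither marked region, so the default 0 of [face_value]
   does not occur. *)
have Fr i : F (r i) = q (face_region black p (r i)).
  have [z bz [E ne]] := rP i; rewrite /F /face_value.
  case: ifP => // /orP[]/eqP Ez; case/eqP: ne; rewrite Ez /marked_region;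
    have := eq_region_black hblack (etrans (esym E) Ez); rewrite bz => ->.
    by rewrite eqxx.
  by rewrite (black_mate hblack) region_mate; case: (black p).
rewrite -[LHS](mulKmx unitG) scalemxAr scalemxAr; congr (_ *m _).
apply/colP => i; rewrite !mxE.
have [z bz [E _]] := rP i.
transitivity (\sum_j goeritz_entry black col (r i) (r j) * F (r j)).
  by apply: eq_bigr => j _; rewrite !mxE Fr.
rewrite (goeritz_row hblack _ hr Fm).
have half (u : rat) : - coloring_sign col / 2 * u =
  coloring_sign col * (- (1 / 2) * u) by field.
rewrite half.
rewrite mulrCA E -bz -(domain_goeritz_row hblack card_arcs hx hy hq z).
apply: eq_bigr => c _; rewrite /edge_src /edge_tgt /F !FE.
by rewrite !(eq_sym _ (region_of z)) !region_of_eq.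
Qed.

Theorem theorem5p2
  (D : diagram) (hdet : link_det D != 0%N)
  (p : dart D) (black : dart D -> bool) (hblack : checkerboard black)
  (c0 : crossing D)
  (k l m : nat)
  (c : 'I_k -> crossing D) (a : 'I_k -> {set dart D})
  (b : 'I_l -> {set dart D}) (w : 'I_m -> {set dart D})
  (hc : enumerates c [set~ c0])
  (ha : enumerates a (arcs D :\ arc_of p))
  (hb : enumerates b (unmarked_regions black p true))
  (hw : enumerates w (unmarked_regions black p false))
  (x y : crossing D -> 'Z_4)
  (hx : kauffman_state black p x) (hy : kauffman_state black p y)
  (outward : bool) (q : {set side D} -> rat)
  (hq : is_domain black p outward x y q) :
  [/\ \col_j q (arc_region black p (a j)) =
        - orientation_sign outward *:
          (invmx (coloring_matrix black c a) *m
             (\col_i xi black x (c i) - \col_i xi black y (c i))),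
      \col_j q (face_region black p (b j)) =
        orientation_sign outward *:
          (- (1 / 2) *: (invmx (goeritz_matrix black true b) *m
             (\col_i degree black true x (b i) -
              \col_i degree black true y (b i)))) &
      \col_j q (face_region black p (w j)) =
        orientation_sign outward *:
          ((1 / 2) *: (invmx (goeritz_matrix black false w) *m
             (\col_i degree black false x (w i) -
              \col_i degree black false y (w i))))].
Proof.
(* Unmarked arcs and unmarked crossings are both indexed by ['I_k], and one of each is marked. *)
have card_arcs : #|arcs D| = #|crossing D|.
  have card_k (T : finType) (f : 'I_k -> T) A : enumerates f A -> #|A| = k.
    by case=> injf <-; rewrite card_imset // card_ord.
  have := cardsD1 (arc_of p) (arcs D); rewrite mem_arcs (card_k _ _ _ ha) => ->.
  have := cardsC1 c0; rewrite (card_k _ _ _ hc) => ->.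
  by rewrite add1n prednK //; apply/card_gt0P; exists c0.
split; last first.
- rewrite (goeritz_solution hblack hdet card_arcs hx hy hq hw).
  by rewrite /coloring_sign opprK.
- rewrite (goeritz_solution hblack hdet card_arcs hx hy hq hb).
  by rewrite /coloring_sign mulNr.
have unitA := coloring_matrix_unit hblack hdet hc ha.
pose H : {set dart D} -> rat := arc_value black p q.
have HE := arc_valueE hblack card_arcs hq.
have Ha j : H (a j) = q (arc_region black p (a j)).
  rewrite /H /arc_value; case: eqP => // E; have : a j \in arcs D :\ arc_of p.
    by case: ha => _ <-; apply: imset_f.
  by rewrite E !inE eqxx.
rewrite -[LHS](mulKmx unitA) scalemxAr; congr (_ *m _).
apply/colP => i; rewrite !mxE -(domain_coloring_row hblack card_arcs hq) -!HE.
(* The marked arc is split off; its term is 0 by the choice of [arc_value]. *)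
rewrite -sum_coloring_entry (big_setD1 _ (mem_arcs p)) /=.
rewrite [X in _ * (_ * X + _)]/arc_value eqxx mulr0 add0r mulr_sumr.
rewrite -(sum_enumerates (fun b => _ * (_ * H b)) ha).
by apply: eq_bigr => j _; rewrite !mxE -/H Ha mulrA.
Qed.
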